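(* Let $R$ be a weakly Einstein algebraic curvature tensor in an oriented Euclidean four-space $\mathcal{T}$, with Einstein tensor $\mathrm{e}$ and Weyl component $W$. Then there exists a positive orthonormal basis $u_1,u_2,u_3,u_4$ of $\mathcal{T}$, consisting of eigenvectors of $\mathrm{e}$, and such that, for each of the two signs $\pm$, the basis $$u_1\wedge u_2\pm u_3\wedge u_4,\quad u_1\wedge u_3\pm u_4\wedge u_2,\quad u_1\wedge u_4\pm u_2\wedge u_3$$ of $\Lambda^\pm$ diagonalizes $W^\pm:\Lambda^\pm\to\Lambda^\pm$.
   Context: $\mathcal{T}$ is an oriented Euclidean four-space with inner product $\mathrm{g}$. An algebraic curvature tensor $R$ in $\mathcal{T}$ is a $(0,4)$ tensor with $R_{ijkl}=-R_{jikl}=-R_{ijlk}=R_{klij}$ and $R_{ijkl}+R_{jkil}+R_{kijl}=0$. In an orthonormal basis, the Ricci tensor is $\mathrm{r}_{ij}=\sum_k R_{ikjk}$, the scalar curvature is $\mathrm{s}=\sum_i \mathrm{r}_{ii}$, the Einstein (traceless Ricci) tensor is $\mathrm{e}=\mathrm{r}-\mathrm{s}\,\mathrm{g}/4$, and the Weyl component is $W_{ijkl}=R_{ijkl}-\frac12(\mathrm{g}_{ik}\mathrm{r}_{jl}+\mathrm{g}_{jl}\mathrm{r}_{ik}-\mathrm{g}_{il}\mathrm{r}_{jk}-\mathrm{g}_{jk}\mathrm{r}_{il})+\frac{\mathrm{s}}6(\mathrm{g}_{ik}\mathrm{g}_{jl}-\mathrm{g}_{il}\mathrm{g}_{jk})$.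 $R$ is called weakly Einstein if the symmetric tensor with components $\sum_{k,p,q}R_{ikpq}R_{jkpq}$ (in an orthonormal basis) is a multiple of $\mathrm{g}$. Eigenvectors of the symmetric tensor $\mathrm{e}$ are taken relative to $\mathrm{g}$. $\Lambda^\pm\subset\mathcal{T}^{\wedge2}$ are the three-dimensional spaces of self-dual and anti-self-dual bivectors; for any positive orthonormal basis $u_1,\dots,u_4$ the bivectors $u_1\wedge u_2\pm u_3\wedge u_4$, $u_1\wedge u_3\pm u_4\wedge u_2$, $u_1\wedge u_4\pm u_2\wedge u_3$ form an orthogonal basis of $\Lambda^\pm$ with vectors of length $\sqrt2$. $W$ acts on bivectors $b$ by $[Wb]_{ij}=\sum_{p,q}W_{ipjq}b_{pq}=\frac12\sum_{p,q}W_{ijpq}b_{pq}$; this action preserves $\Lambda^\pm$, and $W^\pm:\Lambda^\pm\to\Lambda^\pm$ denote its restrictions. *)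

(* Defs.v *)
From HB Require Import structures.
From mathcomp Require Import all_boot all_order all_fingroup all_algebra.
From mathcomp Require Import sesquilinear.
From mathcomp Require Import ring.
From mathcomp Require Import boolp classical_sets reals.

Set Implicit Arguments.
Unset Strict Implicit.
Unset Printing Implicit Defensive.

Import Order.TTheory GRing.Theory Num.Theory.

Local Open Scope ring_scope.

Notation tensor2 T := 'Hom(T, 'Hom(T, _^o)).
Notation tensor4 T := 'Hom(T, 'Hom(T, tensor2 T)).

(* An orientation is an equivalence class of ordered bases, two bases being
   equivalent when the change of basis has positive determinant. *)
Record orientation (R : realType) (T : vectType R) := Orientation {
  positive : pred (4.-tuple T);
  orientation_class : exists2 b : 4.-tuple T, basis_of fullv b &
    forall u : 4.-tuple T, positive u =
      basis_of fullv u && (0 < \det (\matrix_(i, j) coord b j (tnth u i)))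
}.

Lemma linfunE (K : fieldType) (aT rT : vectType K) (f : aT -> rT) :
  linear f -> linfun f =1 f.
Proof.
move=> lf.
pose F := HB.pack_for {linear aT -> rT} f (@GRing.isLinear.Build K aT rT *:%R f lf).
exact: (lfunE F).
Qed.

Lemma mem_leigenspace (K : fieldType) (V : vectType K) (phi : 'End(V)) a v :
  (v \in passmx.leigenspace phi a) = (phi v == a *: v).
Proof.
by rewrite memv_ker add_lfunE opp_lfunE scale_lfunE id_lfunE subr_eq0.
Qed.

Section Form2.
Context {R : realType} {T : vectType R}.

(* [linfun f] is the linear map agreeing with f only when f is linear, so that
   [form2 f] is meaningful for bilinear f only; see [form2E]. *)
Definition form2 (f : T -> T -> R) : tensor2 T :=
  linfun (fun x => linfun (f x : T -> R^o)).

Lemma form2E (f : T -> T -> R) :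
  (forall a x x' y, f (a *: x + x') y = a * f x y + f x' y) ->
  (forall a x y y', f x (a *: y + y') = a * f x y + f x y') ->
  forall x y, form2 f x y = f x y.
Proof.
move=> fl fr x y.
have E z : linfun (f z : T -> R^o) =1 f z by apply: linfunE => a u v; exact: fr.
rewrite /form2 linfunE ?E// => a u v; apply/lfunP => w.
by rewrite add_lfunE scale_lfunE !E fl.
Qed.

Definition diagonalizes (V : vectType R) (U : {vspace V}) (X : seq V)
    (phi : 'End(V)) : Prop :=
  basis_of U X /\ forall b, b \in X -> exists c : R, phi b = c *: b.

Definition algebraic_curvature (Rm : tensor4 T) : Prop :=
  [/\ forall x y z w, Rm x y z w = - Rm y x z w,
      forall x y z w, Rm x y z w = - Rm x y w z,
      forall x y z w, Rm x y z w = Rm z w x y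
    & forall x y z w, Rm x y z w + Rm y z x w + Rm z x y w = 0].

End Form2.

Section Curvature.
Context {R : realType} {T : vectType R}.
Variable g : {dot T for idfun : R -> R}.

(* Some orthonormal basis; it exists as soon as T has dimension 4
   ([onb_orthonormal]), and the contractions below do not depend on which one
   is taken ([contractionE]). *)
Definition onb : 4.-tuple T :=
  xget [tuple 0 | i < 4] [set e : 4.-tuple T | orthonormal g e]%classic.

Lemma dotC x y : g x y = g y x.
Proof. by rewrite (hermC (theta := idfun)) expr0 mul1r. Qed.

Lemma dotDZl a x y z : g (a *: x + y) z = a * g x z + g y z.
Proof. by rewrite linearPl. Qed.

Lemma dotDZr a x y z : g z (a *: x + y) = a * g z x + g z y.
Proof. by rewrite !(dotC z) dotDZl. Qed.

Lemma dot_suml (I : Type) (r : seq I) (F : I -> T) (c : I -> R) z :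
  g (\sum_(i <- r) c i *: F i) z = \sum_(i <- r) c i * g (F i) z.
Proof.
elim: r => [|i r IH]; last by rewrite !big_cons dotDZl IH.
by rewrite !big_nil linear0l.
Qed.

Lemma form_sum n (e : 'I_n -> T) (c d : 'I_n -> R) (h : tensor2 T) :
  h (\sum_i c i *: e i) (\sum_i d i *: e i)
  = \sum_k \sum_l c k * d l * h (e k) (e l).
Proof.
set z := (X in h _ X); rewrite (linear_sum h) sum_lfunE; apply: eq_bigr => k _.
rewrite linearZ /= scale_lfunE /z linear_sum scaler_sumr.
by apply: eq_bigr => l _; rewrite linearZ /= scalerA.
Qed.

Lemma orthonormal_tupleP n (e : n.-tuple T) :
  reflect (forall i j, g (tnth e i) (tnth e j) = (i == j)%:R)
          (orthonormal g e).
Proof.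
have prE (s : seq T) : pair_ortho_rec g s = pairwise (fun x y => g x y == 0) s.
  by elim: s => //= x s ->; rewrite /ortho_rec /= andbT.
rewrite /orthonormal prE.
apply: (iffP andP) => [[/all_tnthP /= n1 /(pairwiseP 0) orth] i j|H].
  have lt (k l : 'I_n) : (k < l)%N -> g (tnth e k) (tnth e l) = 0.
    move=> kl; apply/eqP; rewrite !(tnth_nth 0).
    by apply: orth kl; rewrite inE size_tuple.
  case: (ltngtP i j) => ij.
  - by rewrite lt// -val_eqE (ltn_eqF ij).
  - by rewrite dotC lt// -val_eqE gtn_eqF.
  by rewrite (val_inj ij) (eqP (n1 _)) eqxx.
split; first by apply/all_tnthP => i /=; rewrite H eqxx.
apply/(pairwiseP 0) => i j; rewrite !inE size_tuple => ni nj ij.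
by rewrite -(tnth_nth 0 e (Ordinal ni)) -(tnth_nth 0 e (Ordinal nj)) H -val_eqE
  /= (ltn_eqF ij).
Qed.

Lemma orthonormal_coef n (e : n.-tuple T) (c : 'I_n -> R) j :
  orthonormal g e -> g (\sum_i c i *: tnth e i) (tnth e j) = c j.
Proof.
move=> /orthonormal_tupleP oe; rewrite dot_suml (bigD1 j)//= oe eqxx mulr1.
by rewrite big1 ?addr0// => i /negPf ij; rewrite oe ij mulr0.
Qed.

Section Dimension4.
Hypothesis dimT : \dim {:T} = 4%N.

Lemma onb_orthonormal : orthonormal g onb.
Proof.
suff H n : (n <= 4)%N -> exists e : n.-tuple T, orthonormal g e.
  by have [e oe] := H 4%N isT; apply: (@xgetPex _ _
    [set e : 4.-tuple T | orthonormal g e]%classic); exists e.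
elim: n => [_|n IH n4]; first by exists [tuple].
have [e oe] := IH (ltnW n4).
have /subvPn[v _ vNe] : ~~ (fullv <= <<e>>)%VS.
  apply: contraTN n4 => /dimvS; rewrite dimT -leqNgt => h.
  by rewrite (leq_trans h)// (leq_trans (dim_span _))// size_tuple.
pose w := v - \sum_i g v (tnth e i) *: tnth e i.
have w0 : w != 0.
  apply: contraNneq vNe => /subr0_eq ->.
  by rewrite memv_suml// => i _; rewrite memvZ// memv_span// mem_tnth.
have wort x : x \in e -> g w x = 0.
  case/tnthP => j ->; rewrite /w -scaleN1r addrC dotDZl orthonormal_coef//.
  by rewrite mulN1r addNr.
have gw : 0 < g w w by apply: neq0_dnorm_gt0.
have s0 : Num.sqrt (g w w) != 0 by rewrite sqrtr_eq0 -ltNge.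
exists [tuple of (Num.sqrt (g w w))^-1 *: w :: e].
case/andP: (oe) => h1 h2; rewrite /orthonormal /= h1 h2 /ortho_rec /= !andbT.
apply/andP; split.
  have -> a : g (a *: w) (a *: w) = a ^+ 2 * g w w.
    by rewrite -[a *: w]addr0 dotDZl dotDZr !linear0l !addr0 linear0r addr0 mulrA.
  by rewrite -{2}(sqr_sqrtr (ltW gw)) -exprMn mulVf// expr1n.
apply/allP => x /wort /= gx.
by rewrite -[_ *: w]addr0 dotDZl gx mulr0 linear0l add0r.
Qed.

Lemma orthonormal_basis (e : 4.-tuple T) :
  orthonormal g e -> basis_of fullv e.
Proof.
move=> oe; rewrite basisEfree subvf dimT size_tuple leqnn !andbT.
apply/freeP => k k0 i; rewrite -(orthonormal_coef k i oe).
under eq_bigr do rewrite (tnth_nth 0).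
by rewrite k0 linear0l.
Qed.

Lemma orthonormal_expand (e : 4.-tuple T) x :
  orthonormal g e -> x = \sum_i g x (tnth e i) *: tnth e i.
Proof.
move=> oe; have := coord_basis (orthonormal_basis oe) (memvf x).
under eq_bigr do rewrite -(tnth_nth 0).
move=> xE; rewrite {1}xE; apply: eq_bigr => i _; congr (_ *: _).
by rewrite {2}xE orthonormal_coef.
Qed.

Lemma contractionE (e : 4.-tuple T) (h : tensor2 T) : orthonormal g e ->
  \sum_(v <- onb) h v v = \sum_(v <- e) h v v.
Proof.
move=> oe; have of_ := onb_orthonormal; rewrite !big_tuple.
pose f i := tnth onb i.
have hE i : h (f i) (f i) = \sum_k \sum_l
    g (f i) (tnth e k) * g (f i) (tnth e l) * h (tnth e k) (tnth e l).
  by rewrite -form_sum -orthonormal_expand.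
rewrite (eq_bigr _ (fun i _ => hE i)) exchange_big /=; apply: eq_bigr => k _.
rewrite exchange_big /= (bigD1 k)//= [X in _ + X]big1 ?addr0.
  rewrite -mulr_suml; have := orthonormal_tupleP _ oe k k; rewrite eqxx.
  rewrite {1}(orthonormal_expand (tnth e k) of_) dot_suml => E.
  by under eq_bigr do rewrite {1}dotC; rewrite E mul1r.
move=> l /negPf lk; rewrite -mulr_suml; have := orthonormal_tupleP _ oe k l.
rewrite eq_sym lk {1}(orthonormal_expand (tnth e k) of_) dot_suml => E.
by under eq_bigr do rewrite {1}dotC; rewrite E mul0r.
Qed.

End Dimension4.

Section RicciWeyl.
Variable Rm : tensor4 T.

Definition ricci (x y : T) : R := \sum_(v <- onb) Rm x v y v.

Definition scalar_curvature : R := \sum_(v <- onb) ricci v v.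

Definition einstein (x y : T) : R :=
  ricci x y - scalar_curvature * g x y / 4%:R.

Definition weyl (x y z w : T) : R :=
  Rm x y z w
  - 2%:R^-1 * (g x z * ricci y w + g y w * ricci x z
               - g x w * ricci y z - g y z * ricci x w)
  + scalar_curvature / 6%:R * (g x z * g y w - g x w * g y z).

Definition weakly_einstein : Prop :=
  exists c : R, forall x y : T,
    \sum_(k <- onb) \sum_(p <- onb) \sum_(q <- onb) Rm x k p q * Rm y k p q
    = c * g x y.

Definition weyl_op : 'End(tensor2 T) :=
  linfun (fun b : tensor2 T => form2 (fun x y =>
    \sum_(p <- onb) \sum_(q <- onb) weyl x p y q * b p q)).

Lemma ricci_linear a x x' y :
  ricci (a *: x + x') y = a * ricci x y + ricci x' y.
Proof.
rewrite /ricci mulr_sumr -big_split; apply: eq_bigr => v _ /=.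
by rewrite linearP !(add_lfunE, scale_lfunE).
Qed.

Lemma ricci_linearr a x y y' :
  ricci x (a *: y + y') = a * ricci x y + ricci x y'.
Proof.
rewrite /ricci mulr_sumr -big_split; apply: eq_bigr => v _ /=.
by rewrite linearP !(add_lfunE, scale_lfunE).
Qed.

Lemma weyl_opE b x y :
  weyl_op b x y = \sum_(p <- onb) \sum_(q <- onb) weyl x p y q * b p q.
Proof.
have wl a z z' p w q : weyl (a *: z + z') p w q = a * weyl z p w q + weyl z' p w q.
  by rewrite /weyl linearP !(add_lfunE, scale_lfunE) !dotDZl !ricci_linear /GRing.scale /=; ring.
have wr a z z' p w q : weyl w p (a *: z + z') q = a * weyl w p z q + weyl w p z' q.
  by rewrite /weyl linearP !(add_lfunE, scale_lfunE) !dotDZr !ricci_linearr /GRing.scale /=; ring.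
pose F (b : tensor2 T) x y : R :=
  \sum_(p <- onb) \sum_(q <- onb) weyl x p y q * b p q.
have E c z w : form2 (F c) z w = F c z w.
  apply: form2E => [a u u' v|a u v v']; rewrite /F;
    rewrite mulr_sumr -big_split; apply: eq_bigr => p _ /=;
    rewrite mulr_sumr -big_split; apply: eq_bigr => q _ /=;
    by rewrite (wl, wr) mulrDl mulrA.
rewrite /weyl_op linfunE ?E// => a c c'; apply/lfunP => z; apply/lfunP => w.
rewrite !(add_lfunE, scale_lfunE) !E /F /GRing.scale /=.
rewrite mulr_sumr -big_split; apply: eq_bigr => p _ /=.
rewrite mulr_sumr -big_split; apply: eq_bigr => q _ /=.
by rewrite !(add_lfunE, scale_lfunE) mulrDr mulrCA.
Qed.

End RicciWeyl.

Definition eigenvector (h : T -> T -> R) (x : T) : Prop :=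
  x != 0 /\ exists c : R, forall y : T, h x y = c * g x y.

(* Bivectors are identified through g with skew-symmetric bilinear forms; the
   components of u /\ v are u_i v_j - u_j v_i. *)
Definition bivectors : {vspace tensor2 T} :=
  passmx.leigenspace (linfun (fun b : tensor2 T => form2 (fun x y => b y x))) (-1).

Lemma bivectorsP (b : tensor2 T) :
  reflect (forall x y, b x y = - b y x) (b \in bivectors).
Proof.
have E (c : tensor2 T) z w : form2 (fun x y => c y x) z w = c w z.
  by apply: form2E => *; rewrite linearP ?add_lfunE ?scale_lfunE.
rewrite mem_leigenspace linfunE.
  rewrite scaleN1r; apply: (iffP eqP) => [H x y|H].
    by rewrite -[LHS]E H !opp_lfunE.
  by apply/lfunP => x; apply/lfunP => y; rewrite !opp_lfunE E H.
move=> c d d'; apply/lfunP => x; apply/lfunP => y.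
by rewrite !(add_lfunE, scale_lfunE, E).
Qed.

Definition wedge (u v : T) : tensor2 T :=
  form2 (fun x y => g u x * g v y - g u y * g v x).

Lemma wedgeE u v x y : wedge u v x y = g u x * g v y - g u y * g v x.
Proof.
by apply: form2E => a z z' w; rewrite !dotDZr; ring.
Qed.

Section Hodge.
Variable o : orientation T.

Definition oriented_onb : 4.-tuple T :=
  xget [tuple 0 | i < 4]
    [set e : 4.-tuple T | orthonormal g e && positive o e]%classic.

Lemma oriented_onbP (dimT : \dim {:T} = 4%N) :
  orthonormal g oriented_onb && positive o oriented_onb.
Proof.
apply: (@xgetPex _ _
  [set e : 4.-tuple T | orthonormal g e && positive o e]%classic) => /=.
have [b bb oE] := orientation_class o.
pose M (e : 4.-tuple T) : 'M_4 := \matrix_(i, j) coord b j (tnth e i).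
have oe := onb_orthonormal dimT.
have M0 : \det (M onb) != 0.
  apply/det0P => -[v v0 vM]; case/eqP: v0; apply/rowP => i; rewrite mxE.
  rewrite -(orthonormal_coef (v 0) i oe); set x := \sum_k _.
  suff -> : x = 0 by rewrite linear0l.
  rewrite (coord_basis bb (memvf x)) big1// => j _.
  have -> : coord b j x = 0; last by rewrite scale0r.
  have /rowP/(_ j) := vM; rewrite !mxE => <-; rewrite linear_sum /=.
  by apply: eq_bigr => k _; rewrite linearZ /= mxE.
have [Mpos|Mneg] := ltrP 0 (\det (M onb)).
  by exists onb; rewrite oe oE Mpos orthonormal_basis.
pose s : 'S_4 := tperm ord0 ord_max.
pose e := [tuple tnth onb (s i) | i < 4].
have oe' : orthonormal g e.
  apply/orthonormal_tupleP => i j; rewrite !tnth_mktuple (orthonormal_tupleP _ oe).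
  by rewrite (inj_eq perm_inj).
exists e; rewrite oe' oE orthonormal_basis//=.
have -> : \matrix_(i, j) coord b j (tnth e i) = row_perm s (M onb).
  by apply/matrixP => i j; rewrite !mxE tnth_mktuple.
rewrite row_permE det_mulmx det_perm odd_tperm /= expr1 mulN1r oppr_gt0.
by rewrite lt_neqAle M0.
Qed.

Definition volume (x : 4.-tuple T) : R :=
  \det (\matrix_(i, j) g (tnth x i) (tnth oriented_onb j)).

Lemma volume_linear a x x' (v : 4.-tuple T) i :
  volume [tuple if j == i then a *: x + x' else tnth v j | j < 4]
  = a * volume [tuple if j == i then x else tnth v j | j < 4]
    + volume [tuple if j == i then x' else tnth v j | j < 4].
Proof.
rewrite -[volume [tuple if _ then x' else _ | _ < _]]mul1r /volume; apply: (determinant_multilinear (i0 := i)).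
- apply/rowP => j; rewrite !mxE !tnth_mktuple eqxx dotDZl.
  by rewrite mul1r.
- by apply/matrixP => k j; rewrite !mxE !tnth_mktuple eq_sym (negPf (neq_lift _ _)).
by apply/matrixP => k j; rewrite !mxE !tnth_mktuple eq_sym (negPf (neq_lift _ _)).
Qed.

Definition hodge : 'End(tensor2 T) :=
  linfun (fun b : tensor2 T => form2 (fun x y =>
    2%:R^-1 * \sum_(p <- onb) \sum_(q <- onb) volume [tuple x; y; p; q] * b p q)).

Lemma hodgeE b x y : hodge b x y =
  2%:R^-1 * \sum_(p <- onb) \sum_(q <- onb) volume [tuple x; y; p; q] * b p q.
Proof.
have vl a z z' w p q : volume [tuple a *: z + z'; w; p; q]
    = a * volume [tuple z; w; p; q] + volume [tuple z'; w; p; q].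
  have := volume_linear a z z' [tuple 0; w; p; q] ord0.
  congr (volume _ = _ * volume _ + volume _); apply: eq_from_tnth => i;
    by rewrite tnth_mktuple; case: i => -[|[|[|[|]]]].
have vr a z z' w p q : volume [tuple w; a *: z + z'; p; q]
    = a * volume [tuple w; z; p; q] + volume [tuple w; z'; p; q].
  have := volume_linear a z z' [tuple w; 0; p; q] (lift ord0 ord0).
  congr (volume _ = _ * volume _ + volume _); apply: eq_from_tnth => i;
    by rewrite tnth_mktuple; case: i => -[|[|[|[|]]]].
pose F (b : tensor2 T) x y : R := 2%:R^-1 *
  \sum_(p <- onb) \sum_(q <- onb) volume [tuple x; y; p; q] * b p q.
have E c z w : form2 (F c) z w = F c z w.
  apply: form2E => [a u u' v|a u v v']; rewrite /F mulrCA -mulrDr; congr (_ * _);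
    rewrite mulr_sumr -big_split; apply: eq_bigr => p _ /=;
    rewrite mulr_sumr -big_split; apply: eq_bigr => q _ /=;
    by rewrite (vl, vr) mulrDl mulrA.
rewrite /hodge linfunE ?E// => a c c'; apply/lfunP => z; apply/lfunP => w.
rewrite !(add_lfunE, scale_lfunE) !E /F /GRing.scale /= mulrCA -mulrDr.
congr (_ * _); rewrite mulr_sumr -big_split; apply: eq_bigr => p _ /=.
rewrite mulr_sumr -big_split; apply: eq_bigr => q _ /=.
by rewrite !(add_lfunE, scale_lfunE) mulrDr mulrCA.
Qed.

(* Lambda^+ for s = false, Lambda^- for s = true *)
Definition Lambda (s : bool) : {vspace tensor2 T} :=
  (bivectors :&: passmx.leigenspace hodge ((-1) ^+ s))%VS.

End Hodge.

Definition Lambda_basis (s : bool) (u : 4.-tuple T) : seq (tensor2 T) :=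
  [:: wedge u`_0 u`_1 + (-1) ^+ s *: wedge u`_2 u`_3;
      wedge u`_0 u`_2 + (-1) ^+ s *: wedge u`_3 u`_1;
      wedge u`_0 u`_3 + (-1) ^+ s *: wedge u`_1 u`_2].

End Curvature.

(* Main.v *)
Require Import Defs.
From mathcomp Require Import all_boot all_order all_fingroup all_algebra.
From mathcomp Require Import sesquilinear reals.
From mathcomp Require Import ring lra complex.

(** In the bases of Lambda^+ and Lambda^- attached to a positive orthonormal
    frame, the curvature tensor, viewed as a symmetric operator on bivectors,
    is a matrix with 3 x 3 blocks: A on Lambda^+, B on Lambda^-, and Z and its
    transpose off the diagonal.  By the Bianchi identity W^+ and W^- are A and
    B up to multiples of the identity, while Z carries exactly the traceless
    Ricci tensor e.  A frame is therefore as required as soon as A, B and Z are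
    all diagonal in it ([diagonal_blocks_components], [einstein_eigenvectors],
    [weyl_eigenbivectors]).

    The tensor with components sum R_ikpq R_jkpq is twice the Ricci contraction
    of the square of the curvature operator, and the traceless part of such a
    contraction depends only on the off-diagonal block of the operator, here
    A Z + Z B.  Hence a weakly Einstein tensor satisfies A Z + Z B = 0
    ([curv_square_blocks], [curv_blocks_intertwine]).

    This equation makes A commute with Z Z^T.  A common eigenvector u of the
    two on which Z does not vanish yields, by normalizing its image under Z,
    an eigenvector of B; repeating this in orthogonal complements, and
    diagonalizing A and B separately once Z vanishes there, gives rotations P
    and Q of the two blocks that make A, B and Z diagonal at once
    ([paired_rotations]).

    It remains to realize P and Q by one rotation O of the four-space, that is,
    to prove that SO(4) maps onto SO(3) x SO(3) ([rotation_lift]).  The rotated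
    bases of Lambda^+ and Lambda^- consist of skew matrices I, J, K and
    I', J', K' obeying quaternion relations, and the two triples commute.  The
    symmetric involutions I I', J J', K K' then have a common eigenvector x
    with x I = x I', x J = x J' and x K = x K'; the rows of O are
    x, x I, x J, x K. *)

Set Implicit Arguments.
Unset Strict Implicit.
Unset Printing Implicit Defensive.

Import Order.TTheory GRing.Theory Num.Theory.

Local Open Scope ring_scope.

(** * Simultaneous singular value and spectral decomposition *)

Definition rotation (R : comNzRingType) n (P : 'M[R]_n) : Prop :=
  P *m P^T = 1%:M /\ \det P = 1.

Section Spectral.
Variable R : rcfType.

Lemma row_sqr_ge0 n (x : 'rV[R]_n) : 0 <= (x *m x^T) 0 0.
Proof. by rewrite mxE sumr_ge0 // => i _; rewrite mxE -expr2 sqr_ge0. Qed.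

Lemma row_sqr_eq0 n (x : 'rV[R]_n) : ((x *m x^T) 0 0 == 0) = (x == 0).
Proof.
apply/eqP/eqP => [|->]; last by rewrite mul0mx mxE.
rewrite mxE => /eqP; rewrite psumr_eq0; last first.
  by move=> i _; rewrite mxE -expr2 sqr_ge0.
move=> /allP x0; apply/rowP => i; rewrite [RHS]mxE; apply/eqP.
by have := x0 i (mem_index_enum _); rewrite mxE -expr2 sqrf_eq0.
Qed.

Lemma row_dotC n (x y : 'rV[R]_n) : (x *m y^T) 0 0 = (y *m x^T) 0 0.
Proof. by rewrite -[x *m y^T]trmxK mxE trmx_mul trmxK. Qed.

Lemma symmetric_dotC n (A : 'M[R]_n) (x y : 'rV[R]_n) :
  A^T = A -> (x *m A *m y^T) 0 0 = (y *m A *m x^T) 0 0.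
Proof. by move=> sA; rewrite row_dotC trmx_mul sA mulmxA. Qed.

(** A complex eigenvector x + i y of the restriction of A to U has a real
    eigenvalue, by symmetry of A, so its real and imaginary parts are
    eigenvectors of A as well, and one of them is nonzero. *)
Lemma symmetric_eigenvector m n (A : 'M[R]_n) (U : 'M_(m, n)) :
  A^T = A -> (U *m A <= U)%MS -> U != 0 ->
  exists x : 'rV_n, exists a : R, [/\ x != 0, (x <= U)%MS & x *m A = a *: x].
Proof.
move=> sA UA U0.
have /submxP [D VD] : (row_base U *m A <= row_base U)%MS.
  by rewrite (eqmxMr A (eq_row_base U)) eq_row_base.
have Ugt0 : (0 < \rank U)%N by rewrite lt0n mxrank_eq0.
have [l /eigenvalueP[w wD w0]] :=
  spectral.eigenvalue_closed (map_mx (real_complex R) D) Ugt0.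
(* The real and imaginary parts of the eigenvector, in the ambient space. *)
pose x := map_mx (@complex.Re R) w *m row_base U; pose y := map_mx (@complex.Im R) w *m row_base U.
have xU : (x <= U)%MS by rewrite (submx_trans (submxMl _ _))// eq_row_base.
have yU : (y <= U)%MS by rewrite (submx_trans (submxMl _ _))// eq_row_base.
have ReD : map_mx (@complex.Re R) w *m D =
    complex.Re l *: map_mx (@complex.Re R) w - complex.Im l *: map_mx (@complex.Im R) w.
  apply/rowP => i; have /rowP/(_ i)/(congr1 (@complex.Re R)) := wD.
  rewrite !mxE (raddf_sum (@complex.Re R)) /= => E; apply: etrans (etrans E _).
    by apply: eq_bigr => j _; rewrite !mxE; case: (w 0 j) => a b /=; rewrite mulr0 subr0.
  by case: (l) (w 0 i) => a b [c d].
have ImD : map_mx (@complex.Im R) w *m D =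
    complex.Im l *: map_mx (@complex.Re R) w + complex.Re l *: map_mx (@complex.Im R) w.
  apply/rowP => i; have /rowP/(_ i)/(congr1 (@complex.Im R)) := wD.
  rewrite !mxE (raddf_sum (@complex.Im R)) /= => E; apply: etrans (etrans E _).
    by apply: eq_bigr => j _; rewrite !mxE; case: (w 0 j) => a b /=; rewrite mulr0 add0r.
  by case: (l) (w 0 i) => a b [c d] /=; rewrite addrC.
have xA : x *m A = complex.Re l *: x - complex.Im l *: y.
  by rewrite -mulmxA VD mulmxA ReD mulmxBl -!scalemxAl.
have yA : y *m A = complex.Im l *: x + complex.Re l *: y.
  by rewrite -mulmxA VD mulmxA ImD mulmxDl -!scalemxAl.
have xy0 : (x != 0) || (y != 0).
  rewrite -negb_and; apply: contra w0 => /andP[/eqP x0 /eqP y0].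
  have inj (v : 'rV[R]_(\rank U)) : v *m row_base U = 0 -> v = 0.
    by move=> v0; apply: (row_free_inj (row_base_free U)); rewrite mul0mx.
  have /rowP rw0 := inj _ x0; have /rowP iw0 := inj _ y0.
  apply/eqP/rowP => i; have := rw0 i; have := iw0 i; rewrite !mxE.
  by case: (w 0 i) => a b /= -> ->.
(* (x A) . y = (y A) . x expands to Im l (|x|^2 + |y|^2) = 0. *)
have l0 : complex.Im l = 0.
  have : complex.Im l * ((x *m x^T) 0 0 + (y *m y^T) 0 0) = 0.
    have := symmetric_dotC x y sA; have := row_dotC y x.
    rewrite xA yA mulmxBl mulmxDl -!scalemxAl.
    move: (x *m x^T) (x *m y^T) (y *m x^T) (y *m y^T) => xx xy yx yy yxE.
    rewrite !mxE yxE => /eqP; rewrite -subr_eq0 => /eqP E.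
    by rewrite -[RHS]oppr0 -E; ring.
  move/eqP; rewrite mulf_eq0 paddr_eq0 ?row_sqr_ge0// !row_sqr_eq0.
  by case/orP => [/eqP//|/andP[x0 y0]]; move: xy0; rewrite x0 y0.
case/orP: xy0 => z0; [exists x|exists y]; exists (complex.Re l); split => //.
  by rewrite xA l0 scale0r subr0.
by rewrite yA l0 scale0r add0r.
Qed.

(** The intersection of U with an eigenspace of S is stable under A, since A and
    S commute. *)
Lemma commuting_eigenvector m n (A S : 'M[R]_n) (U : 'M_(m, n)) :
  A^T = A -> S^T = S -> A *m S = S *m A ->
  (U *m A <= U)%MS -> (U *m S <= U)%MS -> U != 0 ->
  exists x : 'rV_n, exists a b : R,
    [/\ x != 0, (x <= U)%MS, x *m A = a *: x & x *m S = b *: x].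
Proof.
move=> sA sS AS UA US U0.
have [x [b [x0 xU xS]]] := symmetric_eigenvector sS US U0.
pose E := (U :&: eigenspace S b)%MS.
have ES : E *m S = b *: E by apply/eigenspaceP; exact: capmxSr.
have EA : (E *m A <= E)%MS.
  rewrite sub_capmx (submx_trans (submxMr A (capmxSl U _)) UA) /=.
  by apply/eigenspaceP; rewrite -mulmxA AS mulmxA ES scalemxAl.
have E0 : E != 0.
  apply: contraNneq x0 => E0; rewrite -submx0 -E0 sub_capmx xU.
  exact/eigenspaceP.
have [y [a [y0 yE yA]]] := symmetric_eigenvector sA EA E0.
exists y, a, b; split=> //; first exact: submx_trans yE (capmxSl _ _).
by apply/eigenspaceP; exact: submx_trans yE (capmxSr _ _).
Qed.

Lemma row_normalize n (x : 'rV[R]_n) :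
  x != 0 -> exists2 c, c != 0 & (c *: x) *m (c *: x)^T = 1%:M.
Proof.
move=> x0; have q0 : 0 < (x *m x^T) 0 0 by rewrite lt0r row_sqr_eq0 x0 row_sqr_ge0.
exists (Num.sqrt ((x *m x^T) 0 0))^-1; first by rewrite invr_eq0 sqrtr_eq0 -ltNge.
rewrite linearZ /= -scalemxAl -scalemxAr scalerA -invfM -expr2 sqr_sqrtr ?ltW//.
by rewrite [LHS]mx11_scalar [in LHS]mxE mulVf ?gt_eqF.
Qed.

(** If Z^T does not vanish on V, then V Z^T is stable under A and Z Z^T, and a
    common eigenvector x of the two in V Z^T is not annihilated by Z: it lies
    in the image of Z^T, and would otherwise be orthogonal to itself.  Its image
    under Z is an eigenvector of B because A Z = - Z B.  If Z^T vanishes on V,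
    then Z vanishes on U, and any eigenvectors of A in U and of B in V will do. *)
Lemma paired_eigenvectors m p n (A B Z : 'M[R]_n) (U : 'M_(m, n)) (V : 'M_(p, n)) :
  A^T = A -> B^T = B -> A *m Z + Z *m B = 0 ->
  (U *m A <= U)%MS -> (V *m B <= V)%MS ->
  (U *m Z <= V)%MS -> (V *m Z^T <= U)%MS -> U != 0 -> V != 0 ->
  exists x y : 'rV_n, exists a b s : R,
    [/\ (x <= U)%MS /\ (y <= V)%MS, x *m x^T = 1%:M /\ y *m y^T = 1%:M,
        x *m A = a *: x /\ y *m B = b *: y,
        x *m Z = s *: y & y *m Z^T = s *: x].
Proof.
move=> sA sB AZB UA VB UZ VZ U0 V0.
have AZ : A *m Z = - (Z *m B) by apply/eqP; rewrite -addr_eq0 AZB.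
have ZA : Z^T *m A = - (B *m Z^T).
  by rewrite -[in LHS]sA -trmx_mul AZ linearN /= trmx_mul sB.
(* When Z^T kills V, the stability of U under Z makes Z kill U. *)
have [VZ0|VZ0] := eqVneq (V *m Z^T) 0.
  have [x [a [x0 xU xA]]] := symmetric_eigenvector sA UA U0.
  have [y [b [y0 yV yB]]] := symmetric_eigenvector sB VB V0.
  have killV (v : 'rV_n) : (v <= V)%MS -> v *m Z^T = 0.
    by case/submxP => t ->; rewrite -mulmxA VZ0 mulmx0.
  have xZ : x *m Z = 0.
    apply/eqP; rewrite -row_sqr_eq0 trmx_mul mulmxA.
    by rewrite killV ?mul0mx ?mxE// (submx_trans (submxMr Z xU) UZ).
  have [c c0 xx] := row_normalize x0; have [d d0 yy] := row_normalize y0.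
  exists (c *: x), (d *: y), a, b, 0; split=> //.
  - by split; rewrite scalemx_sub.
  - by rewrite -!scalemxAl xA yB !scalerA ![c * _]mulrC ![d * _]mulrC.
  - by rewrite -scalemxAl xZ scaler0 scale0r.
  - by rewrite -scalemxAl killV// scaler0 scale0r.
have sS : (Z *m Z^T)^T = Z *m Z^T by rewrite trmx_mul trmxK.
have AS : A *m (Z *m Z^T) = Z *m Z^T *m A.
  by rewrite mulmxA AZ -(mulmxA Z) ZA mulmxN mulNmx mulmxA.
have UA' : (V *m Z^T *m A <= V *m Z^T)%MS.
  by rewrite -mulmxA ZA mulmxN mulmxA -mulNmx submxMr// eqmx_opp.
have US' : (V *m Z^T *m (Z *m Z^T) <= V *m Z^T)%MS.
  by rewrite mulmxA submxMr// (submx_trans (submxMr Z VZ) UZ).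
have [x1 [a [mu [x10 xVZ xA xS]]]] := commuting_eigenvector sA sS AS UA' US' VZ0.
have [c c0 xx] := row_normalize x10; pose x := c *: x1.
have {}xVZ : (x <= V *m Z^T)%MS by rewrite scalemx_sub.
have {}xA : x *m A = a *: x by rewrite -scalemxAl xA !scalerA mulrC.
have {}xS : x *m Z *m Z^T = mu *: x by rewrite -mulmxA -scalemxAl xS !scalerA mulrC.
(* The eigenvalue of Z Z^T at x is |x Z|^2, so x Z / sqrt mu is a unit vector. *)
have muE : mu = ((x *m Z) *m (x *m Z)^T) 0 0.
  by rewrite trmx_mul mulmxA xS -scalemxAl xx !mxE mulr1.
have mu0 : 0 < mu.
  rewrite lt0r muE row_sqr_ge0 andbT row_sqr_eq0; apply: contraNneq (oner_neq0 R) => xZ.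
  have /submxP[t xE] := xVZ; have /matrixP/(_ 0 0) := xx.
  rewrite -/x {2}xE !trmx_mul trmxK !mulmxA xZ !mul0mx !mxE.
  by move=> /esym/eqP.
have r0 : Num.sqrt mu != 0 by rewrite sqrtr_eq0 -ltNge.
have rr : mu = Num.sqrt mu * Num.sqrt mu by rewrite -expr2 sqr_sqrtr ?ltW.
exists x, ((Num.sqrt mu)^-1 *: (x *m Z)), a, (- a), (Num.sqrt mu); split.
- have xU := submx_trans xVZ VZ; split=> //.
  by rewrite scalemx_sub// (submx_trans (submxMr Z xU) UZ).
- split=> //; rewrite linearZ /= -scalemxAl -scalemxAr scalerA -invfM -rr.
  by rewrite [LHS]mx11_scalar [in LHS]mxE -muE mulVf ?gt_eqF.
- split=> //; rewrite -scalemxAl -mulmxA.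
  have -> : Z *m B = - (A *m Z) by rewrite AZ opprK.
  by rewrite mulmxN mulmxA xA -scalemxAl scaleNr scalerN !scalerA mulrC.
- by rewrite scalerA mulfV// scale1r.
- by rewrite -scalemxAl xS scalerA {2}rr mulKf.
Qed.

(** The two orthonormal families grow together, the next pair of vectors being
    taken in their orthogonal complements.  These are stable under A and B and
    exchanged by Z and Z^T because both Z and Z^T relate the two families. *)
Lemma paired_frames n (A B Z : 'M[R]_n) k :
  A^T = A -> B^T = B -> A *m Z + Z *m B = 0 -> (k <= n)%N ->
  exists P Q : 'M_(k, n), exists a b s : 'rV[R]_k,
    [/\ P *m P^T = 1%:M /\ Q *m Q^T = 1%:M,
        P *m A = diag_mx a *m P, Q *m B = diag_mx b *m Q,
        P *m Z = diag_mx s *m Q & Q *m Z^T = diag_mx s *m P].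
Proof.
move=> sA sB AZB; elim: k => [_|k IH kn].
  by exists 0, 0, 0, 0, 0; split; [split|..]; apply/matrixP => -[].
have [P [Q [a [b [s [[PP QQ] PA QB PZ QZ]]]]]] := IH (ltnW kn).
have ker0 (M : 'M[R]_(k, n)) : kermx M^T != 0.
  rewrite -mxrank_eq0 mxrank_ker mxrank_tr -lt0n subn_gt0.
  exact: leq_ltn_trans (rank_leq_row _) kn.
have kerM (L M : 'M[R]_(k, n)) (X : 'M_n) d : L *m X^T = diag_mx d *m M ->
    (kermx M^T *m X <= kermx L^T)%MS.
  move=> LX; apply/sub_kermxP; rewrite -mulmxA.
  have -> : X *m L^T = M^T *m diag_mx d.
    by rewrite -[LHS]trmxK trmx_mul trmxK LX trmx_mul tr_diag_mx.
  by rewrite mulmxA mulmx_ker mul0mx.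
have [PA' QB' PZ'] : [/\ P *m A^T = diag_mx a *m P, Q *m B^T = diag_mx b *m Q
    & P *m Z^T^T = diag_mx s *m Q] by rewrite sA sB trmxK.
have [x [y [a1 [b1 [s1 [[xU yV] [xx yy] [xA yB] xZ yZ]]]]]] :=
  paired_eigenvectors sA sB AZB
    (kerM P P A a PA') (kerM Q Q B b QB') (kerM Q P Z s QZ) (kerM P Q Z^T s PZ')
    (ker0 P) (ker0 Q).
have ext (M N : 'M[R]_(k, n)) (z w : 'rV_n) (X : 'M_n) d d1 :
    M *m X = diag_mx d *m N -> z *m X = d1 *: w ->
    col_mx M z *m X = diag_mx (row_mx d d1%:M) *m col_mx N w.
  move=> MX zX; rewrite diag_mx_row mul_col_mx MX zX mul_block_col !mul0mx.
  rewrite addr0 add0r; congr col_mx; rewrite -mul_scalar_mx; congr (_ *m _).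
  by apply/matrixP => i j; rewrite !mxE !ord1.
have ort (M : 'M[R]_(k, n)) (z : 'rV_n) : M *m M^T = 1%:M -> z *m z^T = 1%:M ->
    (z <= kermx M^T)%MS -> col_mx M z *m (col_mx M z)^T = 1%:M.
  move=> MM zz /sub_kermxP zM; rewrite tr_col_mx mul_col_row MM zz zM.
  by rewrite -[M *m z^T]trmxK trmx_mul trmxK zM trmx0 -scalar_mx_block.
rewrite -addn1; exists (col_mx P x), (col_mx Q y), (row_mx a a1%:M),
  (row_mx b b1%:M), (row_mx s s1%:M); split; [split|..]; by [exact: ort|exact: ext].
Qed.

(** In odd dimension an orthogonal matrix or its opposite has determinant 1, and
    such a change of sign preserves diagonality. *)
Lemma paired_rotations n (A B Z : 'M[R]_n) : odd n ->
  A^T = A -> B^T = B -> A *m Z + Z *m B = 0 ->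
  exists P Q : 'M_n,
    [/\ rotation P, rotation Q,
        is_diag_mx (P *m A *m P^T), is_diag_mx (Q *m B *m Q^T)
      & is_diag_mx (P *m Z *m Q^T)].
Proof.
move=> on sA sB AZB.
have [P [Q [a [b [s [[PP QQ] PA QB PZ _]]]]]] := paired_frames sA sB AZB (leqnn n).
have detS (M : 'M[R]_n) : M *m M^T = 1%:M -> exists2 e : R, e ^+ 2 = 1 & \det (e *: M) = 1.
  move=> MM; exists (\det M); first by rewrite -(det1 R n) -MM det_mulmx det_tr.
  have M2 : \det M ^+ 2 = 1 by rewrite -(det1 R n) -MM det_mulmx det_tr.
  rewrite detZ -{2}[n]odd_double_half on exprD expr1 -mul2n exprM M2 expr1n mulr1.
  by rewrite -expr2.
have [e e2 eP] := detS P PP; have [f f2 fQ] := detS Q QQ.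
have sand (c d : R) (M X N : 'M_n) (v : 'rV_n) : M *m X = diag_mx v *m N ->
    N *m N^T = 1%:M -> is_diag_mx (c *: M *m X *m (d *: N)^T).
  move=> MX NN; rewrite linearZ /= -!scalemxAl -scalemxAr MX -mulmxA NN mulmx1.
  by rewrite scalerA -linearZ diag_mx_is_diag.
exists (e *: P), (f *: Q).
split; [split=> //|split=> //|exact: sand PA PP|exact: sand QB QQ|exact: sand PZ QQ].
  by rewrite linearZ /= -scalemxAl -scalemxAr scalerA -expr2 e2 scale1r.
by rewrite linearZ /= -scalemxAl -scalemxAr scalerA -expr2 f2 scale1r.
Qed.
End Spectral.

(** * Self-dual and anti-self-dual matrices *)

(** Matrices given by functions of natural numbers have entries that reduce by
    computation at concrete indices. *)
Lemma mx_nat (V : Type) m n (M : 'M[V]_(m.+1, n.+1)) :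
  exists f : nat -> nat -> V, M = \matrix_(i, j) f i j.
Proof.
exists (fun i j => M (inord i) (inord j)).
by apply/matrixP => i j; rewrite mxE !inord_val.
Qed.

Local Notation ord3 k := (@Ordinal 3 k isT).
Local Notation ord4 k := (@Ordinal 4 k isT).

Section BivectorMatrices.
Variable R : comNzRingType.

(** The cofactor expansion along first rows, in a form that reduces by
    computation at a concrete size. *)
Fixpoint cofactor_det n (f : nat -> nat -> R) : R :=
  if n isn't m.+1 then 1 else
  foldr (fun j d => (-1) ^+ j * f 0 j *
                    cofactor_det m (fun i k => f i.+1 (bump j k)) + d)
        0 (iota 0 m.+1).

Lemma cofactor_detE n (f : nat -> nat -> R) :
  \det (\matrix_(i < n, j < n) f i j) = cofactor_det n f.
Proof.
elim: n f => [|n IH] f; first by rewrite det_mx00.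
have foldE (F : nat -> R) s : foldr (fun j d => F j + d) 0 s = \sum_(j <- s) F j.
  by elim: s => [|j s /= ->]; rewrite (big_nil, big_cons).
rewrite (expand_det_row _ 0) [RHS]foldE -[iota _ _]/(index_iota 0 n.+1) big_mkord.
apply: eq_bigr => j _; rewrite mxE mulrCA mulrA.
rewrite -[in RHS]/(cofactor_det n _) -IH; congr (_ * _ * \det _).
by apply/matrixP => i k; rewrite !mxE.
Qed.

Definition cross (p q : 'rV[R]_3) : 'rV[R]_3 :=
  \row_k [:: p 0 (ord3 1) * q 0 (ord3 2) - p 0 (ord3 2) * q 0 (ord3 1);
             p 0 (ord3 2) * q 0 (ord3 0) - p 0 (ord3 0) * q 0 (ord3 2);
             p 0 (ord3 0) * q 0 (ord3 1) - p 0 (ord3 1) * q 0 (ord3 0)]`_k.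

(** The components of a (u_0 /\ u_1 + e u_2 /\ u_3) + b (u_0 /\ u_2 + e u_3 /\ u_1)
    + c (u_0 /\ u_3 + e u_1 /\ u_2) in an orthonormal frame u. *)
Definition bivec_entry (e a b c : R) (i j : nat) : R :=
  (nth [::] [:: [::   0;       a;       b;       c ];
                [:: - a;       0;   e * c; - (e * b)];
                [:: - b; - (e * c);     0;   e * a ];
                [:: - c;   e * b; - (e * a);     0 ]] i)`_j.

Definition bivec (s : bool) (p : 'rV[R]_3) : 'M[R]_4 :=
  \matrix_(i, j)
    bivec_entry ((-1) ^+ s) (p 0 (ord3 0)) (p 0 (ord3 1)) (p 0 (ord3 2)) i j.

Definition row3 (a b c : R) : 'rV[R]_3 := \row_i [:: a; b; c]`_i.

Lemma row3P (p : 'rV[R]_3) : exists a b c, p = row3 a b c.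
Proof.
have [f ->] := mx_nat p; exists (f 0 0), (f 0 1), (f 0 2).
by apply/rowP => -[[|[|[|//]]] ?]; rewrite !mxE.
Qed.

Lemma delta_row3 (a : 'I_3) :
  delta_mx 0 a = row3 (a == 0 :> nat)%:R (a == 1 :> nat)%:R (a == 2 :> nat)%:R.
Proof.
by apply/rowP => i; rewrite !mxE; case: a i => [[|[|[|//]]] ?] [[|[|[|//]]] ?].
Qed.

Lemma bivec_row3 s a b c :
  bivec s (row3 a b c) = \matrix_(i, j) bivec_entry ((-1) ^+ s) a b c i j.
Proof. by apply/matrixP => i j; rewrite !mxE. Qed.

Lemma cross_row3 a b c a' b' c' : cross (row3 a b c) (row3 a' b' c')
  = row3 (b * c' - c * b') (c * a' - a * c') (a * b' - b * a').
Proof. by apply/rowP => i; rewrite !mxE. Qed.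

Lemma dot_row3 a b c a' b' c' :
  (row3 a b c *m (row3 a' b' c')^T) 0 0 = a * a' + b * b' + c * c'.
Proof. by rewrite mxE !big_ord_recl big_ord0 !mxE /= addr0 addrA. Qed.

Lemma mulmx4 (f g : nat -> nat -> R) :
  (\matrix_(i < 4, k < 4) f i k) *m (\matrix_(k < 4, j < 4) g k j) =
  \matrix_(i, j) (f i 0 * g 0 j + f i 1 * g 1 j + f i 2 * g 2 j + f i 3 * g 3 j).
Proof.
apply/matrixP => i j; rewrite [LHS]mxE.
by under eq_bigr do rewrite !mxE; rewrite !big_ord_recl big_ord0 mxE /= addr0 !addrA.
Qed.

Lemma bivec_linear s k p q : bivec s (k *: p + q) = k *: bivec s p + bivec s q.
Proof.
apply/matrixP => i j; rewrite !mxE.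
by case: i j => [[|[|[|[|//]]]] ?] [[|[|[|[|//]]]] ?]; rewrite /bivec_entry /=; ring.
Qed.

Lemma tr_bivec s p : (bivec s p)^T = - bivec s p.
Proof.
apply/matrixP => i j; rewrite !mxE.
by case: i j => [[|[|[|[|//]]]] ?] [[|[|[|[|//]]]] ?]; rewrite /bivec_entry /= ?(opprK, oppr0).
Qed.

(** Up to sign these are the rules for multiplying imaginary quaternions: the
    self-dual and the anti-self-dual matrices are two copies of the imaginary
    quaternions, with opposite orientations. *)
Lemma bivec_mul s p q :
  bivec s p *m bivec s q = - (p *m q^T) 0 0 *: 1%:M - (-1) ^+ s *: bivec s (cross p q).
Proof.
have [a [b [c ->]]] := row3P p; have [a' [b' [c' ->]]] := row3P q.
rewrite dot_row3 cross_row3 !bivec_row3 mulmx4.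
have: (-1) ^+ s * (-1) ^+ s = 1 :> R by rewrite -expr2 sqrr_sign.
move: ((-1) ^+ s) => e ee; apply/matrixP => i j; rewrite !mxE.
by case: i j => [[|[|[|[|//]]]] ?] [[|[|[|[|//]]]] ?]; rewrite /bivec_entry /=; ring: ee.
Qed.

Lemma bivec_comm p q : bivec false p *m bivec true q = bivec true q *m bivec false p.
Proof.
have [a [b [c ->]]] := row3P p; have [a' [b' [c' ->]]] := row3P q.
rewrite !bivec_row3 !mulmx4; apply/matrixP => i j; rewrite !mxE.
by case: i j => [[|[|[|[|//]]]] ?] [[|[|[|[|//]]]] ?]; rewrite /bivec_entry /=; ring.
Qed.

Lemma trace_bivec_mul p q : \tr (bivec false p *m bivec true q) = 0.
Proof.
have [a [b [c ->]]] := row3P p; have [a' [b' [c' ->]]] := row3P q.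
rewrite !bivec_row3 !mulmx4 /mxtrace.
under eq_bigr do rewrite mxE.
by rewrite !big_ord_recl big_ord0 /bivec_entry /=; ring.
Qed.

(** The cross product of two rows has inner products 0, 0 and the determinant
    with the three rows, and P^T is invertible. *)
Lemma cross_rows_rotation (P : 'M[R]_3) : rotation P ->
  [/\ cross (row (ord3 0) P) (row (ord3 1) P) = row (ord3 2) P,
      cross (row (ord3 1) P) (row (ord3 2) P) = row (ord3 0) P
    & cross (row (ord3 2) P) (row (ord3 0) P) = row (ord3 1) P].
Proof.
move=> [PP dP].
suff H i j k : cross (row i P) (row j P) *m P^T = \det P *: delta_mx 0 k ->
    cross (row i P) (row j P) = row k P.
  by split; apply: H; have [f ->] := mx_nat P; rewrite cofactor_detE;
    apply/rowP => -[[|[|[|//]]] ?]; rewrite /= ?(mxE, big_ord_recl, big_ord0) /=;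
    rewrite /bump /=; ring.
move=> ck; rewrite -[LHS]mulmx1 -(mulmx1C PP) mulmxA ck dP scale1r.
by rewrite -rowE.
Qed.

Definition pfaffian (M : 'M[R]_4) :=
  M (ord4 0) (ord4 1) * M (ord4 2) (ord4 3)
  - M (ord4 0) (ord4 2) * M (ord4 1) (ord4 3)
  + M (ord4 0) (ord4 3) * M (ord4 1) (ord4 2).

Lemma pfaffian_identity (f : nat -> nat -> R) (a b c e : R) :
  let d i j k l := f i k * f j l - f i l * f j k in
  let F i j := a * (d i j 0 1 + e * d i j 2 3) + b * (d i j 0 2 + e * d i j 3 1)
    + c * (d i j 0 3 + e * d i j 1 2) in
  F 0 1 * F 2 3 - F 0 2 * F 1 3 + F 0 3 * F 1 2
  = cofactor_det 4 f * (e * (a * a + b * b + c * c)).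
Proof.
move=> d F; rewrite /F /d /= /bump /=.
move: (f 0 0) (f 0 1) (f 0 2) (f 0 3) (f 1 0) (f 1 1) (f 1 2) (f 1 3) => *.
move: (f 2 0) (f 2 1) (f 2 2) (f 2 3) (f 3 0) (f 3 1) (f 3 2) (f 3 3) => *.
ring.
Qed.

Lemma pfaffian_bivec s p : pfaffian (bivec s p) = (-1) ^+ s * (p *m p^T) 0 0.
Proof.
have [a [b [c ->]]] := row3P p.
by rewrite dot_row3 bivec_row3 /pfaffian !mxE /bivec_entry /=; ring.
Qed.

Lemma conj_bivecE (f : nat -> nat -> R) s (a b c : R) (i j : 'I_4) :
  let O := \matrix_(i < 4, j < 4) f i j in
  let d k l := f i k * f j l - f i l * f j k in
  (O *m bivec s (row3 a b c) *m O^T) i j =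
    a * (d 0 1 + (-1) ^+ s * d 2 3) + b * (d 0 2 + (-1) ^+ s * d 3 1)
    + c * (d 0 3 + (-1) ^+ s * d 1 2).
Proof.
move=> O d; have -> : O^T = \matrix_(i < 4, j < 4) f j i by apply/matrixP => ? ?; rewrite !mxE.
rewrite bivec_row3 mulmx4 mxE !big_ord_recl big_ord0 !mxE /d /bivec_entry /=.
by move: ((-1) ^+ s) => e; ring.
Qed.

(** The case of self-dual and anti-self-dual matrices of the rule that
    congruence by O multiplies the Pfaffian by the determinant of O.  It decides
    the orientation of the frame built in [rotation_lift]. *)
Lemma pfaffian_conj (O : 'M[R]_4) s p :
  pfaffian (O *m bivec s p *m O^T) = \det O * pfaffian (bivec s p).
Proof.
have [f ->] := mx_nat O; have [a [b [c ->]]] := row3P p.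
by rewrite cofactor_detE pfaffian_bivec dot_row3 [in LHS]/pfaffian !conj_bivecE pfaffian_identity.
Qed.

Lemma crossC p q : cross p q = - cross q p.
Proof.
apply/rowP => i; rewrite !mxE.
by case: i => -[|[|[|//]]] ?; rewrite /= opprB ![q _ _ * _]mulrC.
Qed.

Lemma crossvv p : cross p p = 0.
Proof.
apply/rowP => i; rewrite !mxE.
by case: i => -[|[|[|//]]] ? /=; rewrite mulrC subrr.
Qed.

Lemma bivec0 s : bivec s 0 = 0.
Proof. by have := bivec_linear s (-1) 0 0; rewrite scaler0 addr0 scaleN1r addNr. Qed.

Lemma bivecN s p : bivec s (- p) = - bivec s p.
Proof. by rewrite -[- p]addr0 -scaleN1r bivec_linear bivec0 addr0 scaleN1r. Qed.

Definition quaternion_table (e : R) (I J K : 'M[R]_4) : Prop :=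
  [/\ I *m I = - 1%:M, J *m J = - 1%:M, K *m K = - 1%:M,
      [/\ I *m J = - e *: K, J *m K = - e *: I & K *m I = - e *: J]
    & [/\ J *m I = e *: K, K *m J = e *: I & I *m K = e *: J]].

Lemma bivec_quaternions (s : bool) (P : 'M[R]_3) : rotation P ->
  quaternion_table ((-1) ^+ s) (bivec s (row (ord3 0) P)) (bivec s (row (ord3 1) P))
    (bivec s (row (ord3 2) P)).
Proof.
move=> rP; have [PP _] := rP; have [c2 c0 c1] := cross_rows_rotation rP.
have dot i j : (row i P *m (row j P)^T) 0 0 = (i == j)%:R.
  have -> : (i == j)%:R = (P *m P^T) i j by rewrite PP mxE.
  by rewrite !mxE; apply: eq_bigr => k _; rewrite !mxE.
split; [..|split|split]; rewrite bivec_mul dot ?eqxx ?crossvv ?bivec0 ?scaler0 ?subr0 ?scaleN1r//=.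
all: rewrite ?mulr0n ?oppr0 ?scale0r ?add0r ?(c0, c1, c2) ?scaleNr//.
all: by rewrite crossC ?(c0, c1, c2) bivecN scalerN opprK.
Qed.
Definition frame_mx (x y0 y1 y2 : 'rV[R]_4) : 'M[R]_4 :=
  \matrix_(i < 4) nth 0 [:: x; y0; y1; y2] i.

(** Multiplication by I, J and K sends each of x, x I, x J, x K to plus or minus
    another one, by the quaternion table, in the pattern of the basis matrices. *)
Lemma frame_mx_intertwines (s : bool) x I J K O :
  quaternion_table ((-1) ^+ s) I J K ->
  O = frame_mx x (x *m I) (x *m J) (x *m K) ->
  [/\ bivec s (delta_mx 0 (ord3 0)) *m O = O *m I,
      bivec s (delta_mx 0 (ord3 1)) *m O = O *m J
    & bivec s (delta_mx 0 (ord3 2)) *m O = O *m K].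
Proof.
move=> [II JJ KK [IJ JK KI] [JI KJ IK]] ->.
split; apply/row_matrixP => i; rewrite !row_mul mulmx_sum_row !big_ord_recl big_ord0;
  rewrite !rowK !mxE; case: i => [[|[|[|[|//]]]] ?];
  rewrite /bivec_entry /= ?(mulr1n, mulr0n, mulr0, mulr1, oppr0, scale0r, scale1r, add0r, addr0) //;
  rewrite -mulmxA ?(II, JJ, KK, IJ, JK, KI, JI, KJ, IK) ?mulmxN ?mulmx1 ?scaleN1r //.
all: by rewrite -scalemxAr.
Qed.

Lemma quaternion_table_rot e I J K :
  quaternion_table e I J K -> quaternion_table e J K I.
Proof. by case=> ? ? ? [? ? ?] [? ? ?]; split. Qed.

(** Both sides expand to I + I' + J K' - K J', the signs of the two tables being
    opposite. *)
Lemma quaternion_intertwiner (I J K I' J' K' : 'M[R]_4) :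
  quaternion_table 1 I J K -> quaternion_table (- 1) I' J' K' ->
  I' *m I = I *m I' -> J' *m I = I *m J' -> K' *m I = I *m K' ->
  let Pr := 1%:M - (I *m I' + J *m J' + K *m K') in Pr *m I = Pr *m I'.
Proof.
move=> [II _ _ [_ _ KI] [JI _ _]] [II' _ _ [_ _ KI'] [JI' _ _]] cI cJ cK Pr.
rewrite !mulmxBl !mul1mx !mulmxDl -!mulmxA cI cJ cK II' KI' JI'.
rewrite mulmxA II mulmxA JI mulmxA KI opprK !scale1r !scaleN1r !mulmxN !mulmx1 !mulNmx mul1mx.
rewrite !opprD !opprK !addrA [I + I']addrC -!addrA; congr (_ + (_ + _)).
by rewrite addrC.
Qed.

End BivectorMatrices.

Section RotationLift.
Variable R : rcfType.

Lemma skew_row_eq0 n (M : 'M[R]_n) (x : 'rV_n) : M^T = - M -> x *m M *m x^T = 0.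
Proof.
move=> MN; have E : (x *m M *m x^T)^T = - (x *m M *m x^T).
  by rewrite !trmx_mul trmxK MN mulNmx mulmxN mulmxA.
move: (_ *m x^T) E => N /matrixP/(_ 0 0); rewrite !mxE => /eqP.
rewrite -addr_eq0 -mulr2n mulrn_eq0 /= => /eqP N0.
by apply/matrixP => i j; rewrite !ord1 N0 mxE.
Qed.

(** The matrix Pr is four times the projection onto the required vectors x.  It is
    nonzero because its trace is 4, the products I I', J J', K K' being
    traceless. *)
Lemma common_quaternion_vector (P Q : 'M[R]_3) : rotation P -> rotation Q ->
  exists x : 'rV[R]_4, [/\ x *m x^T = 1%:M,
    x *m bivec false (row (ord3 0) P) = x *m bivec true (row (ord3 0) Q),
    x *m bivec false (row (ord3 1) P) = x *m bivec true (row (ord3 1) Q)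
  & x *m bivec false (row (ord3 2) P) = x *m bivec true (row (ord3 2) Q)].
Proof.
move=> rP rQ.
have TI := bivec_quaternions false rP; have TI' := bivec_quaternions true rQ.
rewrite expr0 in TI; rewrite expr1 in TI'.
have TJ := quaternion_table_rot TI; have TJ' := quaternion_table_rot TI'.
have TK := quaternion_table_rot TJ; have TK' := quaternion_table_rot TJ'.
have C (p q : 'rV[R]_3) := esym (bivec_comm p q).
have prI := quaternion_intertwiner TI TI' (C _ _) (C _ _) (C _ _).
have prJ := quaternion_intertwiner TJ TJ' (C _ _) (C _ _) (C _ _).
have prK := quaternion_intertwiner TK TK' (C _ _) (C _ _) (C _ _).
move: prI prJ prK; rewrite /=.
set I := bivec false _; set J := bivec false _; set K := bivec false _.
set I' := bivec true _; set J' := bivec true _; set K' := bivec true _ => prI prJ prK.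
pose Pr := 1%:M - (I *m I' + J *m J' + K *m K').
have EJ : Pr = 1%:M - (J *m J' + K *m K' + I *m I').
  by congr (_ - _); rewrite -addrA addrC.
have EK : Pr = 1%:M - (K *m K' + I *m I' + J *m J').
  by congr (_ - _); rewrite addrC addrA.
rewrite -/Pr in prI; rewrite -EJ in prJ; rewrite -EK in prK.
have Pr0 : Pr != 0.
  apply: contra_eq_neq (mxtrace1 R 4) => Pr0.
  have := congr1 mxtrace Pr0; rewrite mxtrace0 linearB !linearD /= !trace_bivec_mul.
  rewrite !addr0 subr0 => ->; by rewrite eq_sym pnatr_eq0.
have [i xi] : exists i, row i Pr != 0.
  apply/existsP; apply: contraNT Pr0; rewrite negb_exists => /forallP r0.
  by apply/eqP/row_matrixP => i; rewrite row0; apply/eqP; have := r0 i; rewrite negbK.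
have [c _ xx] := row_normalize xi.
exists (c *: row i Pr); split=> //; rewrite -!scalemxAl -!row_mul; congr (_ *: row _ _).
- exact: prI.
- exact: prJ.
- exact: prK.
Qed.

(** The rows x, x I, x J, x K are orthonormal because products of distinct
    quaternion units are skew.  Since x I = x I' and likewise for J and K, the
    same matrix O intertwines both triples with the standard ones, and its
    determinant is found by comparing Pfaffians. *)
Lemma rotation_lift (P Q : 'M[R]_3) : rotation P -> rotation Q ->
  exists O : 'M[R]_4, rotation O /\
    forall (s : bool) p, O^T *m bivec s p *m O = bivec s (p *m (if s then Q else P)).
Proof.
move=> rP rQ; have [x [xx xI xJ xK]] := common_quaternion_vector rP rQ.
have TI := bivec_quaternions false rP; have TI' := bivec_quaternions true rQ.
pose O := frame_mx x (x *m bivec false (row (ord3 0) P))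
  (x *m bivec false (row (ord3 1) P)) (x *m bivec false (row (ord3 2) P)).
have O' : O = frame_mx x (x *m bivec true (row (ord3 0) Q))
  (x *m bivec true (row (ord3 1) Q)) (x *m bivec true (row (ord3 2) Q)).
  by rewrite -xI -xJ -xK.
have [fI fJ fK] := frame_mx_intertwines TI (erefl O).
have [tI tJ tK] := frame_mx_intertwines TI' O'.
pose I := bivec false (row (ord3 0) P); pose J := bivec false (row (ord3 1) P).
pose K := bivec false (row (ord3 2) P).
have OO : O *m O^T = 1%:M.
  pose M (i : 'I_4) := nth 0 [:: 1%:M; I; J; K] i.
  have Ox i : row i O = x *m M i.
    by rewrite rowK; case: i => [[|[|[|[|//]]]] ?] /=; rewrite ?mulmx1.
  case: TI => II JJ KK [IJ JK KI] [JI KJ IK].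
  have tr := tr_bivec (R := R) false.
  have MM i j : x *m (M i *m (M j)^T) *m x^T = (i == j)%:R *: 1%:M.
    have [<-|ij] := eqVneq i j.
      (* Each of 1, I, J, K is orthogonal. *)
      have -> : M i *m (M i)^T = 1%:M; last by rewrite mulmx1 xx scale1r.
      case: i => [[|[|[|[|//]]]] ?]; rewrite /M /I /J /K /= ?trmx1 ?mulmx1 // tr mulmxN;
      by rewrite ?(II, JJ, KK) opprK.
    rewrite scale0r skew_row_eq0// trmx_mul trmxK.
    case: i j ij => [[|[|[|[|//]]]] ?] [[|[|[|[|//]]]] ?] //= _;
    rewrite /M /I /J /K /= ?trmx1 ?mulmx1 ?mul1mx ?tr ?opprK // !mulmxN ?opprK;
    by rewrite ?(IJ, JK, KI, JI, KJ, IK) ?scaleNr ?opprK ?scale1r.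
  apply/matrixP => i j; rewrite [RHS]mxE.
  have <- : (x *m (M i *m (M j)^T) *m x^T) 0 0 = (i == j)%:R by rewrite MM !mxE mulr1.
  rewrite mulmxA -mulmxA -trmx_mul -!Ox !mxE.
  by apply: eq_bigr => k _; rewrite !mxE.
have tab (s : bool) p : bivec s p *m O = O *m bivec s (p *m (if s then Q else P)).
  have pE : p = p 0 (ord3 0) *: delta_mx 0 (ord3 0) +
      (p 0 (ord3 1) *: delta_mx 0 (ord3 1) + (p 0 (ord3 2) *: delta_mx 0 (ord3 2) + 0)).
    by rewrite [LHS]row_sum_delta !big_ord_recl big_ord0;
      do 3!(congr (p 0 _ *: delta_mx 0 _ + _); try exact: val_inj).
  rewrite pE !mulmxDl -!scalemxAl -!rowE mul0mx !bivec_linear bivec0 !addr0.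
  rewrite !mulmxDl !mulmxDr -!scalemxAl -!scalemxAr.
  by case: s; rewrite ?(tI, tJ, tK) ?(fI, fJ, fK).
have conj (s : bool) p : O^T *m bivec s p *m O = bivec s (p *m (if s then Q else P)).
  by rewrite -mulmxA tab mulmxA (mulmx1C OO) mul1mx.
exists O; split=> //; split=> //.
(* Both of the matrices compared here have Pfaffian 1. *)
have := pfaffian_conj O^T false (delta_mx 0 (ord3 0)); rewrite trmxK conj !pfaffian_bivec det_tr.
rewrite expr0 !mul1r trmx_mul mulmxA -(mulmxA _ P) (proj1 rP) mulmx1.
by rewrite trmx_delta mul_delta_mx mxE !eqxx mulr1 => <-.
Qed.

End RotationLift.

(** * The curvature operator in blocks *)

Section Components.
Variable R : comNzRingType.
Implicit Types (h : nat -> nat -> R) (r : nat -> nat -> nat -> nat -> R).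

(** Over a ring in which 2 is a zero divisor, vanishing on the diagonal is a
    condition of its own. *)
Definition skew h := (forall i j, h i j = - h j i) /\ forall i, h i i = 0.

Definition pairing (M : 'M[R]_4) h : R := \sum_i \sum_j M i j * h i j.

(** The plane complementary to the one spanned by the frame vectors 0 and a + 1,
    positively ordered. *)
Definition opposite_pair (a : nat) : nat * nat :=
  nth (0, 0)%N [:: (2, 3); (3, 1); (1, 2)]%N a.

Lemma sum4 (F : nat -> R) : \sum_(i < 4) F i = F 0 + F 1 + F 2 + F 3.
Proof. by rewrite !big_ord_recl big_ord0 /= addr0 !addrA. Qed.

Lemma pairing_nat (f h : nat -> nat -> R) :
  pairing (\matrix_(i, j) f i j) h =
  \sum_(i < 4) (f i 0 * h i 0 + f i 1 * h i 1 + f i 2 * h i 2 + f i 3 * h i 3).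
Proof.
apply: eq_bigr => i _; rewrite -(sum4 (fun j => f i j * h i j)).
by apply: eq_bigr => j _; rewrite mxE.
Qed.

Lemma pairing_row3 s a b c h :
  pairing (bivec s (row3 a b c)) h =
  a * (h 0 1 - h 1 0 + (-1) ^+ s * (h 2 3 - h 3 2))
  + b * (h 0 2 - h 2 0 + (-1) ^+ s * (h 3 1 - h 1 3))
  + c * (h 0 3 - h 3 0 + (-1) ^+ s * (h 1 2 - h 2 1)).
Proof.
rewrite bivec_row3 pairing_nat.
rewrite (sum4 (fun i => _ i 0 * h i 0 + _ i 1 * h i 1 + _ i 2 * h i 2 + _ i 3 * h i 3)).
by rewrite /bivec_entry /=; move: ((-1) ^+ s) => e; ring.
Qed.

Lemma pairing_delta s (a : 'I_3) h : skew h ->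
  pairing (bivec s (delta_mx 0 a)) h =
  2 * (h 0 a.+1 + (-1) ^+ s * h (opposite_pair a).1 (opposite_pair a).2).
Proof.
move=> [sh _]; rewrite delta_row3 pairing_row3.
rewrite (sh 1 0) (sh 2 0) (sh 3 0) (sh 2 1) (sh 3 2) (sh 1 3).
by case: a => [[|[|[|//]]] ?] /=; move: ((-1) ^+ s) => e; ring.
Qed.

(** Up to a constant factor, the block of the curvature operator between
    Lambda^s and Lambda^t, where false stands for + and true for -. *)
Definition curv_block r (s t : bool) : 'M[R]_3 :=
  \matrix_(a, b) pairing (bivec s (delta_mx 0 a))
                   (fun i j => pairing (bivec t (delta_mx 0 b)) (r i j)).

Definition curv_square r (i j : nat) : R :=
  \sum_(k < 4) \sum_(p < 4) \sum_(q < 4) r i k p q * r j k p q.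

Definition curvature_symmetries r :=
  [/\ forall i j k l, r i j k l = - r j i k l, forall i k l, r i i k l = 0
    & forall i j k l, r i j k l = r k l i j].

Lemma curv_skew r i j : curvature_symmetries r -> skew (r i j).
Proof.
case=> r1 r0 rs; split=> [k l|k]; last by rewrite rs r0.
by rewrite rs r1 rs.
Qed.

Lemma pairing_skew r M : curvature_symmetries r ->
  skew (fun i j => pairing M (r i j)).
Proof.
case=> r1 r0 rs; split=> [i j|i].
  rewrite /pairing -sumrN; apply: eq_bigr => k _; rewrite -sumrN.
  by apply: eq_bigr => l _; rewrite r1 mulrN.
by rewrite /pairing big1// => k _; rewrite big1// => l _; rewrite r0 mulr0.
Qed.

Lemma curv_blockE r s t (a b : 'I_3) : curvature_symmetries r ->
  let a' := opposite_pair a in let b' := opposite_pair b in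
  curv_block r s t a b =
  4 * (r 0 a.+1 0 b.+1 + (-1) ^+ t * r 0 a.+1 b'.1 b'.2
       + (-1) ^+ s * (r a'.1 a'.2 0 b.+1 + (-1) ^+ t * r a'.1 a'.2 b'.1 b'.2)).
Proof.
move=> sr a' b'; rewrite mxE pairing_delta; last exact: pairing_skew.
by rewrite !pairing_delta; do ?exact: curv_skew; move: ((-1) ^+ s) ((-1) ^+ t) => e f; ring.
Qed.

Definition skew_dot h h' : R :=
  h 0 1 * h' 0 1 + h 0 2 * h' 0 2 + h 0 3 * h' 0 3
  + h 2 3 * h' 2 3 + h 3 1 * h' 3 1 + h 1 2 * h' 1 2.

Lemma skew_sum2 h h' : skew h -> skew h' ->
  \sum_(p < 4) \sum_(q < 4) h p q * h' p q =
  2 * skew_dot h h'.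
Proof.
move=> [sh h0] [sh' h0'].
under eq_bigr do rewrite (sum4 (fun q => h _ q * h' _ q)).
rewrite (sum4 (fun p => h p _ * h' p _ + h p _ * h' p _ + h p _ * h' p _ + h p _ * h' p _)).
rewrite !h0 !h0' (sh 1 0) (sh 2 0) (sh 3 0) (sh 2 1) (sh 3 2) (sh 1 3).
rewrite (sh' 1 0) (sh' 2 0) (sh' 3 0) (sh' 2 1) (sh' 3 2) (sh' 1 3) /skew_dot.
ring.
Qed.

Lemma curv_squareE r i j : curvature_symmetries r ->
  curv_square r i j =
  2 * (skew_dot (r i 0) (r j 0) + skew_dot (r i 1) (r j 1)
       + skew_dot (r i 2) (r j 2) + skew_dot (r i 3) (r j 3)).
Proof.
move=> sr; rewrite /curv_square -(sum4 (fun k => skew_dot (r i k) (r j k))) mulr_sumr.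
by apply: eq_bigr => k _; rewrite (skew_sum2 (curv_skew _ _ sr) (curv_skew _ _ sr)).
Qed.

End Components.

Section PairingTheory.
Variable R : comNzRingType.
Implicit Types (h : nat -> nat -> R) (r : nat -> nat -> nat -> nat -> R).

Lemma eq_pairing (M : 'M[R]_4) h h' :
  (forall i j, (i < 4)%N -> (j < 4)%N -> h i j = h' i j) ->
  pairing M h = pairing M h'.
Proof. by move=> hh; do 2!apply: eq_bigr => ? _; rewrite hh. Qed.

Lemma pairing_exchange (M N : 'M[R]_4) r :
  pairing M (fun i j => pairing N (r i j))
  = pairing N (fun k l => pairing M (fun i j => r i j k l)).
Proof.
rewrite /pairing.
under eq_bigr => i _ do under eq_bigr => j _ do rewrite mulr_sumr.
under [RHS]eq_bigr => k _ do under eq_bigr => l _ do rewrite mulr_sumr.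
rewrite pair_big [RHS]pair_big /=.
under eq_bigr => p _ do under eq_bigr => k _ do rewrite mulr_sumr.
under [RHS]eq_bigr => p _ do under eq_bigr => k _ do rewrite mulr_sumr.
under eq_bigr => p _ do rewrite pair_big /=.
under [RHS]eq_bigr => p _ do rewrite pair_big /=.
rewrite exchange_big; apply: eq_bigr => p _; apply: eq_bigr => q _.
by rewrite mulrCA.
Qed.

Lemma pairing_linear k (M N : 'M[R]_4) h :
  pairing (k *: M + N) h = k * pairing M h + pairing N h.
Proof.
rewrite /pairing mulr_sumr -big_split; apply: eq_bigr => i _ /=.
rewrite mulr_sumr -big_split; apply: eq_bigr => j _ /=.
by rewrite !mxE mulrDl mulrA.
Qed.

Lemma pairing0 h : pairing 0 h = 0.
Proof. by rewrite /pairing big1// => i _; rewrite big1// => j _; rewrite mxE mul0r. Qed.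

Lemma pairing_bivec_sum s (p : 'rV[R]_3) h :
  pairing (bivec s p) h = \sum_a p 0 a * pairing (bivec s (delta_mx 0 a)) h.
Proof.
rewrite {1}[p]row_sum_delta; elim/big_rec2: _ => [|a x y _ IH].
  by rewrite bivec0 pairing0.
by rewrite bivec_linear pairing_linear IH.
Qed.

Lemma curv_block_bivec r s t (P Q : 'M[R]_3) a b :
  pairing (bivec s (row a P)) (fun i j => pairing (bivec t (row b Q)) (r i j))
  = (P *m curv_block r s t *m Q^T) a b.
Proof.
rewrite pairing_bivec_sum -mulmxA mxE; apply: eq_bigr => c _.
rewrite [row a P _ _]mxE; congr (_ * _).
rewrite pairing_exchange pairing_bivec_sum mxE; apply: eq_bigr => d _.
by rewrite mulrC !mxE pairing_exchange.
Qed.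

(** The hypotheses say that r' is r written in the frame changed by O, and that O
    acts on Lambda^s through P s. *)
Lemma curv_block_conj r r' (O : 'M[R]_4) (P : bool -> 'M[R]_3) s t :
  (forall M N, pairing M (fun i j => pairing N (r' i j)) =
    pairing (O^T *m M *m O) (fun i j => pairing (O^T *m N *m O) (r i j))) ->
  (forall s p, O^T *m bivec s p *m O = bivec s (p *m P s)) ->
  curv_block r' s t = P s *m curv_block r s t *m (P t)^T.
Proof.
by move=> rr' OP; apply/matrixP => a b; rewrite mxE rr' !OP -!rowE curv_block_bivec.
Qed.
Lemma tr_curv_block r s t :
  curvature_symmetries r -> (curv_block r s t)^T = curv_block r t s.
Proof.
move=> [_ _ rs]; apply/matrixP => a b; rewrite !mxE pairing_exchange.
by apply: eq_pairing => k l _ _; apply: eq_pairing => i j _ _.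
Qed.

Lemma skew_dotC h h' : skew_dot h h' = skew_dot h' h.
Proof. by rewrite /skew_dot; do 5!(congr (_ + _); last exact: mulrC); exact: mulrC. Qed.

Lemma skew_dotNl h k h' : (forall i j, h i j = - k i j) ->
  skew_dot h h' = - skew_dot k h'.
Proof. by move=> hk; rewrite /skew_dot !hk !mulNr -!opprD. Qed.

Lemma skew_dot0l h h' : (forall i j, h i j = 0) -> skew_dot h h' = 0.
Proof. by move=> h0; rewrite /skew_dot !h0 !mul0r !addr0. Qed.

(** In the sum over c of A_ac (Z^T)_bc + Z_ac B_bc, with each block written as
    sums and differences of rows of the curvature operator, the products of
    components on opposite planes cancel. *)
Lemma curv_blocks_skew_dot r (a b : 'I_3) : curvature_symmetries r ->
  let a' := opposite_pair a in let b' := opposite_pair b in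
  (curv_block r false false *m curv_block r false true
   + curv_block r false true *m curv_block r true true) a b
  = 32 * (skew_dot (r 0 a.+1) (r 0 b.+1) - skew_dot (r 0 a.+1) (r b'.1 b'.2)
          + (skew_dot (r a'.1 a'.2) (r 0 b.+1)
             - skew_dot (r a'.1 a'.2) (r b'.1 b'.2))).
Proof.
move=> sr a' b'.
have tr s t c : curv_block r s t c b = curv_block r t s b c.
  by rewrite -(tr_curv_block _ _ sr) mxE.
rewrite !mxE.
under eq_bigr do rewrite [curv_block _ _ _ _ b]tr !curv_blockE//.
under [X in _ + X]eq_bigr do rewrite [curv_block _ _ _ _ b]tr !curv_blockE//.
rewrite -/a' -/b' !big_ord_recl !big_ord0 /skew_dot /= /bump /= !expr0 !expr1.
move: (r 0 a.+1) (r a'.1 a'.2) (r 0 b.+1) (r b'.1 b'.2) => x x' y y'.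
by ring.
Qed.

(** The products of a self-dual and an anti-self-dual basis matrix span the
    traceless symmetric matrices; pairing the contracted square of the curvature
    operator with one of them isolates an entry of the off-diagonal block of
    that square.  The factor - 8 comes from the normalization of
    [curv_block]. *)
Lemma curv_square_blocks r (a b : 'I_3) : curvature_symmetries r ->
  (curv_block r false false *m curv_block r false true
   + curv_block r false true *m curv_block r true true) a b
  = - 8 * pairing (bivec false (delta_mx 0 a) *m bivec true (delta_mx 0 b)) (curv_square r).
Proof.
move=> sr; rewrite curv_blocks_skew_dot//.
rewrite !delta_row3 !bivec_row3 mulmx4 /pairing !big_ord_recl !big_ord0 !mxE.
have dotC i j k l : skew_dot (r i j) (r k l) = skew_dot (r k l) (r i j).
  exact: skew_dotC.
have [r1 r0 _] := sr.
have flip i j h : skew_dot (r j i) h = - skew_dot (r i j) h by exact: skew_dotNl.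
have flipr i j h : skew_dot h (r j i) = - skew_dot h (r i j).
  by rewrite ![skew_dot h _]skew_dotC flip.
have zero i h : skew_dot (r i i) h = 0 by exact: skew_dot0l.
have zeror i h : skew_dot h (r i i) = 0 by rewrite skew_dotC zero.
(* Up to sign, only inner products of the rows of the six planes 01, 02, 03, 23,
   31, 12 occur; their order is then normalized too. *)
pose canon := (zero 0, zero 1, zero 2, zero 3, zeror 0, zeror 1, zeror 2, zeror 3,
  flip 0 1, flip 0 2, flip 0 3, flip 1 2, flip 2 3, flip 3 1,
  flipr 0 1, flipr 0 2, flipr 0 3, flipr 1 2, flipr 2 3, flipr 3 1).
pose swap := (dotC 0 2 0 1, dotC 0 3 0 1, dotC 0 3 0 2, dotC 2 3 0 1, dotC 2 3 0 2,
  dotC 2 3 0 3, dotC 3 1 0 1, dotC 3 1 0 2, dotC 3 1 0 3, dotC 3 1 2 3,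
  dotC 1 2 0 1, dotC 1 2 0 2, dotC 1 2 0 3, dotC 1 2 2 3, dotC 1 2 3 1)%N.
case: a b => [[|[|[|//]]] ?] [[|[|[|//]]] ?];
  rewrite /= /bivec_entry /bump /= ?expr0 ?expr1 oppr0 !(mulr0, mul0r) !(addr0, add0r);
  rewrite !curv_squareE // !canon ?swap; ring.
Qed.
End PairingTheory.

(** * Curvature components with diagonal blocks *)

Section Diagonal.
Variable R : rcfType.
Implicit Types (r : nat -> nat -> nat -> nat -> R).

(** A multiple of the identity pairs to zero with every product of a self-dual and
    an anti-self-dual matrix, such products being traceless. *)
Lemma curv_blocks_intertwine r c : curvature_symmetries r ->
  (forall i j, (i < 4)%N -> (j < 4)%N -> curv_square r i j = c * (i == j)%:R) ->
  curv_block r false false *m curv_block r false true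
  + curv_block r false true *m curv_block r true true = 0.
Proof.
move=> sr rc; apply/matrixP => a b; rewrite curv_square_blocks// [RHS]mxE.
set M := _ *m _; suff -> : pairing M (curv_square r) = c * \tr M.
  by rewrite trace_bivec_mul !mulr0.
rewrite /pairing mulr_sumr; apply: eq_bigr => i _.
rewrite (bigD1 i)//= rc// eqxx mulr1 mulrC big1 ?addr0// => j ji.
by rewrite rc// val_eqE eq_sym (negPf ji) !mulr0.
Qed.

(** The curvature operator sends each of the planes spanned by u_0 and u_a to a
    combination of itself and of its orthogonal complement, and likewise for
    the complementary planes. *)
Definition diagonal_components r :=
  forall a b : 'I_3, a != b ->
  let a' := opposite_pair a in let b' := opposite_pair b in
  [/\ r 0 a.+1 0 b.+1 = 0, r 0 a.+1 b'.1 b'.2 = 0, r a'.1 a'.2 0 b.+1 = 0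
    & r a'.1 a'.2 b'.1 b'.2 = 0].

(** For fixed a and b the four blocks determine the four components by an
    invertible linear system. *)
Lemma diagonal_blocks_components r : curvature_symmetries r ->
  is_diag_mx (curv_block r false false) -> is_diag_mx (curv_block r true true) ->
  is_diag_mx (curv_block r false true) -> diagonal_components r.
Proof.
move=> sr dff dtt dft a b ab a' b'.
(* The remaining block is the transpose of the third one. *)
have dtf : curv_block r true false a b = 0.
  rewrite -(tr_curv_block false true sr) mxE.
  by apply: (is_diag_mxP dft); rewrite eq_sym.
have {dff} := is_diag_mxP dff a b ab; have {dtt} := is_diag_mxP dtt a b ab.
have {dft} := is_diag_mxP dft a b ab; move: dtf.
rewrite !curv_blockE// -/a' -/b' !expr0 !expr1.
by move=> h1 h2 h3 h4; split; lra.
Qed.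

(** The position, in the list 01, 02, 03, 23, 31, 12 of coordinate planes, of
    the plane spanned by the frame vectors i and j; meaningful for distinct i
    and j only, the sign being 0 otherwise. *)
Definition bivector_index (i j : nat) : nat :=
  nth 0%N (nth [::] [:: [:: 0; 0; 1; 2]; [:: 0; 0; 5; 4]; [:: 1; 5; 0; 3];
                        [:: 2; 4; 3; 0]]%N i) j.

Definition bivector_sign (i j : nat) : R := bivec_entry 1 1 1 1 i j.

(** The tensor whose operator on bivectors, in the basis of coordinate planes
    ordered as 01, 02, 03, 23, 31, 12, consists of four diagonal blocks. *)
Definition diagonal_curv (x0 x1 x2 y0 y1 y2 w0 w1 w2 : R) i j k l : R :=
  bivector_sign i j * bivector_sign k l *
  (nth [::] [:: [:: x0; 0; 0; y0; 0; 0]; [:: 0; x1; 0; 0; y1; 0];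
                [:: 0; 0; x2; 0; 0; y2]; [:: y0; 0; 0; w0; 0; 0];
                [:: 0; y1; 0; 0; w1; 0]; [:: 0; 0; y2; 0; 0; w2]]
       (bivector_index i j))`_(bivector_index k l).

Lemma diagonal_componentsE r i j k l :
  curvature_symmetries r -> diagonal_components r ->
  (i < 4)%N -> (j < 4)%N -> (k < 4)%N -> (l < 4)%N ->
  r i j k l = diagonal_curv (r 0 1 0 1) (r 0 2 0 2) (r 0 3 0 3)
    (r 0 1 2 3) (r 0 2 3 1) (r 0 3 1 2) (r 2 3 2 3) (r 3 1 3 1) (r 1 2 1 2) i j k l.
Proof.
move=> sr d.
have [x01 y01 z01 w01] := d (ord3 0) (ord3 1) isT.
have [x02 y02 z02 w02] := d (ord3 0) (ord3 2) isT.
have [x12 y12 z12 w12] := d (ord3 1) (ord3 2) isT.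
have [x10 y10 z10 w10] := d (ord3 1) (ord3 0) isT.
have [x20 y20 z20 w20] := d (ord3 2) (ord3 0) isT.
have [x21 y21 z21 w21] := d (ord3 2) (ord3 1) isT.
have zero := (x01, y01, z01, w01, x02, y02, z02, w02, x12, y12, z12, w12,
  x10, y10, z10, w10, x20, y20, z20, w20, x21, y21, z21, w21).
rewrite /= in zero.
pose pair_of p : nat * nat :=
  nth (0, 0)%N [:: (0, 1); (0, 2); (0, 3); (2, 3); (3, 1); (1, 2)]%N p.
have expand h m n : skew h -> (m < 4)%N -> (n < 4)%N -> h m n = bivector_sign m n *
    h (pair_of (bivector_index m n)).1 (pair_of (bivector_index m n)).2.
  move=> [sh h0]; case: m n => [|[|[|[|//]]]] [|[|[|[|//]]]] _ _;
  by rewrite /bivector_sign /bivec_entry /= ?(mul1r, mulr1, mulN1r, mul0r) -?sh ?h0.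
case: (sr) => r1 r0 rs i4 j4 k4 l4.
rewrite (expand _ _ _ (curv_skew i j sr) k4 l4).
rewrite [r i j _ _]rs (expand _ _ _ (curv_skew _ _ sr) i4 j4) mulrCA mulrA /diagonal_curv.
have : (bivector_index i j < 6)%N by case: i j i4 j4 => [|[|[|[|//]]]] [|[|[|[|//]]]].
have : (bivector_index k l < 6)%N by case: k l k4 l4 => [|[|[|[|//]]]] [|[|[|[|//]]]].
move: (bivector_index i j) (bivector_index k l) => p q q6 p6; congr (_ * _).
by case: p q p6 q6 => [|[|[|[|[|[|//]]]]]] [|[|[|[|[|[|//]]]]]] //= _ _; rewrite ?zero // rs.
Qed.

Definition ricci_components r i j : R := \sum_(k < 4) r i k j k.

Definition weyl_components r i j k l : R :=
  let g (m n : nat) : R := (m == n)%:R in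
  r i j k l
  - 2^-1 * (g i k * ricci_components r j l + g j l * ricci_components r i k
            - g i l * ricci_components r j k - g j k * ricci_components r i l)
  + (\sum_(m < 4) ricci_components r m m) / 6 * (g i k * g j l - g i l * g j k).

Section DiagonalWeyl.
Variables x0 x1 x2 y0 y1 y2 w0 w1 w2 : R.
Let dc := diagonal_curv x0 x1 x2 y0 y1 y2 w0 w1 w2.
Let rho := [:: x0 + x1 + x2; x0 + w1 + w2; x1 + w0 + w2; x2 + w0 + w1].

Lemma ricci_diagonal i j : (i < 4)%N -> (j < 4)%N ->
  ricci_components dc i j = (i == j)%:R * rho`_i.
Proof.
rewrite /ricci_components (sum4 (fun k => dc i k j k)).
case: i j => [|[|[|[|//]]]] [|[|[|[|//]]]] _ _;
by rewrite /dc /diagonal_curv /bivector_sign /bivec_entry /=; ring.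
Qed.

Lemma weyl_diagonalE i j k l :
  (i < 4)%N -> (j < 4)%N -> (k < 4)%N -> (l < 4)%N ->
  weyl_components dc i j k l =
  dc i j k l - (2^-1 * (rho`_i + rho`_j) - (x0 + x1 + x2 + w0 + w1 + w2) / 3)
    * ((i == k)%:R * (j == l)%:R - (i == l)%:R * (j == k)%:R).
Proof.
move=> i4 j4 k4 l4; rewrite /weyl_components (sum4 (fun m => ricci_components dc m m)).
rewrite !ricci_diagonal // /rho /= !mul1r; move: (dc i j k l) => d.
by field.
Qed.

(** The Bianchi identity enters as y0 + y1 + y2 = 0.  The eigenvalue is read off
    at the entry (0, a + 1), where the basis bivector has component 1. *)
Lemma weyl_diagonal (s : bool) (a : 'I_3) :
  y0 + y1 + y2 = 0 ->
  exists c : R, forall i j, (i < 4)%N -> (j < 4)%N ->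
    pairing (bivec s (delta_mx 0 a)) (fun p q => weyl_components dc i p j q) =
    c * bivec_entry ((-1) ^+ s) (a == 0 :> nat)%:R (a == 1 :> nat)%:R (a == 2 :> nat)%:R i j.
Proof.
move=> y; pose v i j := pairing (bivec s (delta_mx 0 a)) (fun p q => weyl_components dc i p j q).
exists (v 0 a.+1) => i j i4 j4; rewrite -/(v i j).
have y2E : y2 = - y0 - y1.
  by apply: (addrI (y0 + y1)); rewrite y addrACA !subrr addr0.
have e_sign : (-1) ^+ s = 1 :> R \/ (-1) ^+ s = -1 :> R.
  by case: s {v}; [right|left].
rewrite /v delta_row3 !pairing_row3 {v}; move: ((-1) ^+ s) e_sign => e e_sign.
case: a => [[|[|[|//]]] ?]; rewrite /= !(mul0r, mul1r) !(add0r, addr0);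
  rewrite !weyl_diagonalE // /dc /rho y2E;
  case: i j i4 j4 => [|[|[|[|//]]]] [|[|[|[|//]]]] _ _;
  rewrite /diagonal_curv /bivector_sign /bivec_entry /=;
  by case: e_sign => ->; field.
Qed.
End DiagonalWeyl.
End Diagonal.

(** * Tensors in an orthonormal frame *)

Section Frames.
Context {R : realType} {T : vectType R}.
Variable g : {dot T for idfun : R -> R}.
Hypothesis dimT : \dim {:T} = 4%N.
Variable Rm : tensor4 T.
Hypothesis hRm : algebraic_curvature Rm.

Definition bilinear2 (F : T -> T -> R) : Prop :=
  (forall a x x' y, F (a *: x + x') y = a * F x y + F x' y) /\
  (forall a x y y', F x (a *: y + y') = a * F x y + F x y').

Lemma sum_frame (e : 4.-tuple T) (F : T -> R) :
  \sum_(v <- e) F v = \sum_(i < 4) F e`_i.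
Proof. by rewrite big_tuple; apply: eq_bigr => i _; rewrite (tnth_nth 0). Qed.

(** The contractions in the definitions are taken in one fixed orthonormal basis;
    this moves them to any orthonormal frame. *)
Lemma onb_sumE (e : 4.-tuple T) (F : T -> T -> R) :
  orthonormal g e -> bilinear2 F ->
  \sum_(v <- onb g) F v v = \sum_(i < 4) F e`_i e`_i.
Proof.
move=> oe [Fl Fr]; rewrite -(sum_frame e (fun v => F v v)).
under eq_bigr do rewrite -(form2E Fl Fr).
by rewrite (contractionE dimT (form2 F) oe); apply: eq_bigr => v _; rewrite form2E.
Qed.

Lemma bilinear2_sum (I : Type) (s : seq I) (F : I -> T -> T -> R) :
  (forall i, bilinear2 (F i)) -> bilinear2 (fun x y => \sum_(i <- s) F i x y).
Proof.
move=> bF; split=> [a x x' y|a x y y']; rewrite mulr_sumr -big_split;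
  by apply: eq_bigr => i _; case: (bF i) => Fl Fr; rewrite ?Fl ?Fr.
Qed.

Lemma curvature_linear1 a x x' y z w :
  Rm (a *: x + x') y z w = a * Rm x y z w + Rm x' y z w.
Proof. by rewrite linearP !(add_lfunE, scale_lfunE). Qed.

Lemma curvature_linear2 a x y y' z w :
  Rm x (a *: y + y') z w = a * Rm x y z w + Rm x y' z w.
Proof. by rewrite linearP !(add_lfunE, scale_lfunE). Qed.

Lemma curvature_linear3 a x y z z' w :
  Rm x y (a *: z + z') w = a * Rm x y z w + Rm x y z' w.
Proof. by rewrite linearP !(add_lfunE, scale_lfunE). Qed.

Lemma curvature_linear4 a x y z w w' :
  Rm x y z (a *: w + w') = a * Rm x y z w + Rm x y z w'.
Proof. by rewrite linearP. Qed.

Let lin := (curvature_linear1, curvature_linear2, curvature_linear3,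
  curvature_linear4).

Definition frame_curv (e : 4.-tuple T) (i j k l : nat) : R :=
  Rm e`_i e`_j e`_k e`_l.

Lemma frame_curv_symmetries (e : 4.-tuple T) : curvature_symmetries (frame_curv e).
Proof.
case: hRm => r1 _ rs _; split=> [i j k l|i k l|i j k l]; [exact: r1| |exact: rs].
by apply/eqP; have /eqP := r1 e`_i e`_i e`_k e`_l; rewrite -addr_eq0 -mulr2n mulrn_eq0.
Qed.

(** Each of the three sums is a contraction of a bilinear form, and is moved to the
    frame e in turn. *)
Lemma weakly_einstein_frame (e : 4.-tuple T) : orthonormal g e -> weakly_einstein g Rm ->
  exists c, forall i j, (i < 4)%N -> (j < 4)%N ->
    curv_square (frame_curv e) i j = c * (i == j)%:R.
Proof.
move=> oe [c cE]; exists c => i j i4 j4.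
have /orthonormal_tupleP/(_ (Ordinal i4) (Ordinal j4)) := oe.
rewrite !(tnth_nth 0) -val_eqE /= => <-; rewrite -cE.
have bq x y k p : bilinear2 (fun q q' => Rm x k p q * Rm y k p q').
  by split=> *; rewrite !lin; ring.
have bp x y k : bilinear2 (fun p p' => \sum_(q < 4) Rm x k p e`_q * Rm y k p' e`_q).
  by apply: bilinear2_sum => q; split=> *; rewrite !lin; ring.
have bk x y : bilinear2 (fun k k' => \sum_(p < 4) \sum_(q < 4)
    Rm x k e`_p e`_q * Rm y k' e`_p e`_q).
  by do 2!apply: bilinear2_sum => ?; split=> *; rewrite !lin; ring.
apply: esym.
under eq_bigr => k _.
  under eq_bigr => p _ do rewrite (onb_sumE oe (bq _ _ k p)).
  rewrite (onb_sumE oe (bp _ _ k)); over.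
exact: (onb_sumE oe (bk _ _)).
Qed.

Lemma ricci_frame (e : 4.-tuple T) x y : orthonormal g e ->
  ricci g Rm x y = \sum_(k < 4) Rm x e`_k y e`_k.
Proof.
move=> oe; rewrite /ricci (onb_sumE (F := fun v v' => Rm x v y v') oe)//.
by split=> *; rewrite !lin.
Qed.

Lemma scalar_curvature_frame (e : 4.-tuple T) : orthonormal g e ->
  scalar_curvature g Rm = \sum_(m < 4) ricci g Rm e`_m e`_m.
Proof.
move=> oe; rewrite /scalar_curvature (onb_sumE (F := ricci g Rm) oe)//.
by split=> *; rewrite (ricci_linear, ricci_linearr).
Qed.

Lemma weyl_frame (e : 4.-tuple T) i j k l : orthonormal g e ->
  (i < 4)%N -> (j < 4)%N -> (k < 4)%N -> (l < 4)%N ->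
  weyl g Rm e`_i e`_j e`_k e`_l = weyl_components (frame_curv e) i j k l.
Proof.
move=> oe i4 j4 k4 l4.
have gE m n : (m < 4)%N -> (n < 4)%N -> g e`_m e`_n = (m == n)%:R.
  move=> m4 n4; have /orthonormal_tupleP/(_ (Ordinal m4) (Ordinal n4)) := oe.
  by rewrite !(tnth_nth 0) -val_eqE.
have rE m n : ricci g Rm e`_m e`_n = ricci_components (frame_curv e) m n.
  exact: ricci_frame.
rewrite /weyl (scalar_curvature_frame oe) !gE// !rE /weyl_components.
by under eq_bigr do rewrite rE.
Qed.

Lemma weyl_op_frame (e : 4.-tuple T) b x y : orthonormal g e ->
  weyl_op g Rm b x y = \sum_(p < 4) \sum_(q < 4) weyl g Rm x e`_p y e`_q * b e`_p e`_q.
Proof.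
move=> oe; rewrite weyl_opE.
have wl a z z' p w q : weyl g Rm p (a *: z + z') w q = a * weyl g Rm p z w q + weyl g Rm p z' w q.
  by rewrite /weyl !lin ?dotDZl ?dotDZr ?ricci_linear ?ricci_linearr; ring.
have wr a z z' p w q : weyl g Rm w p q (a *: z + z') = a * weyl g Rm w p q z + weyl g Rm w p q z'.
  by rewrite /weyl !lin ?dotDZl ?dotDZr ?ricci_linear ?ricci_linearr; ring.
have bq p p' : bilinear2 (fun q q' => weyl g Rm x p y q * b p' q').
  split=> [a q q' z|a q z z']; first by rewrite wr mulrDl mulrA.
  by rewrite linearP mulrDr mulrCA.
have bp : bilinear2 (fun p p' => \sum_(q < 4) weyl g Rm x p y e`_q * b p' e`_q).
  apply: bilinear2_sum => q; split=> [a p p' z|a p z z'].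
    by rewrite wl mulrDl mulrA.
  by rewrite linearP !(add_lfunE, scale_lfunE) mulrDr mulrCA.
under eq_bigr => p _ do rewrite (onb_sumE oe (bq p p)).
exact: (onb_sumE oe bp).
Qed.
End Frames.

(** * Self-dual and anti-self-dual bivectors of a frame *)

Section LeviCivita.
Variable R : comNzRingType.

Definition levi_civita (i j p q : nat) : R :=
  cofactor_det 4 (fun a b => (nth 0 [:: i; j; p; q] a == b)%:R)%N.

(** Only the complementary plane contributes to the contraction, with sign 1. *)
Lemma levi_civita_dual (a : 'I_3) (h : nat -> nat -> R) :
  let p := opposite_pair a in
  skew_dot (levi_civita 0 a.+1) h = h p.1 p.2 /\
  skew_dot (levi_civita p.1 p.2) h = h 0 a.+1.
Proof.
case: a => [[|[|[|//]]] ?]; split;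
  rewrite /skew_dot /levi_civita /cofactor_det /bump /= !(mulr0, mul0r) !(addr0, add0r);
  ring.
Qed.
End LeviCivita.

Section FrameTensors.
Context {R : realType} {T : vectType R}.
Variable g : {dot T for idfun : R -> R}.
Hypothesis dimT : \dim {:T} = 4%N.
Variable u : 4.-tuple T.
Hypothesis ou : orthonormal g u.

Lemma frame_dot i j : (i < 4)%N -> (j < 4)%N -> g u`_i u`_j = (i == j)%:R.
Proof.
move=> i4 j4; have /orthonormal_tupleP/(_ (Ordinal i4) (Ordinal j4)) := ou.
by rewrite !(tnth_nth 0) -val_eqE.
Qed.

Lemma tensor2_eq (b b' : tensor2 T) :
  (forall i j, (i < 4)%N -> (j < 4)%N -> b u`_i u`_j = b' u`_i u`_j) -> b = b'.
Proof.
move=> bb; apply/lfunP => x; apply/lfunP => y.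
rewrite (orthonormal_expand dimT x ou) (orthonormal_expand dimT y ou) !form_sum.
by apply: eq_bigr => k _; apply: eq_bigr => l _; rewrite !(tnth_nth 0) bb.
Qed.

Lemma bivector_eq (b b' : tensor2 T) : b \in bivectors -> b' \in bivectors ->
  (forall a : 'I_3, b u`_0 u`_a.+1 = b' u`_0 u`_a.+1 /\
     let p := opposite_pair a in b u`_p.1 u`_p.2 = b' u`_p.1 u`_p.2) -> b = b'.
Proof.
move=> /bivectorsP sb /bivectorsP sb' bb.
have [e0 f0] := bb (ord3 0); have [e1 f1] := bb (ord3 1); have [e2 f2] := bb (ord3 2).
have diag x : b x x = b' x x.
  have d0 (c : tensor2 T) : (forall y z, c y z = - c z y) -> c x x = 0.
    by move=> sc; apply/eqP; have /eqP := sc x x; rewrite -addr_eq0 -mulr2n mulrn_eq0.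
  by rewrite !d0.
rewrite /= in e0 f0 e1 f1 e2 f2.
by apply: tensor2_eq => i j; case: i j => [|[|[|[|//]]]] [|[|[|[|//]]]] _ _ //;
  rewrite sb [RHS]sb'; congr (- _).
Qed.

Lemma wedge_frame i j k l : (i < 4)%N -> (j < 4)%N -> (k < 4)%N -> (l < 4)%N ->
  wedge g u`_i u`_j u`_k u`_l =
  (i == k)%:R * (j == l)%:R - (i == l)%:R * (j == k)%:R.
Proof. by move=> *; rewrite wedgeE !frame_dot. Qed.

Lemma wedge_bivector x y : wedge g x y \in bivectors.
Proof. by apply/bivectorsP => z w; rewrite !wedgeE opprB. Qed.

Lemma Lambda_basis_frame s (a : 'I_3) i j : (i < 4)%N -> (j < 4)%N ->
  (Lambda_basis g s u)`_a u`_i u`_j = bivec s (delta_mx 0 a) (inord i) (inord j).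
Proof.
move=> i4 j4; rewrite delta_row3 bivec_row3 mxE !inordK //.
case: a => [[|[|[|//]]] ?]; rewrite /= !(add_lfunE, scale_lfunE) !wedge_frame //.
all: move: ((-1) ^+ s) => e; rewrite /GRing.scale /=.
all: by case: i j i4 j4 => [|[|[|[|//]]]] [|[|[|[|//]]]] _ _; rewrite /bivec_entry /=; ring.
Qed.

Variable o : orientation T.
Hypothesis du : \det (\matrix_(i, j) g (tnth u i) (tnth (oriented_onb g o) j)) = 1.

(** The hypothesis on the determinant makes u a positive frame, so its volume is
    that of the standard basis. *)
Lemma volume_frame i j p q :
  (i < 4)%N -> (j < 4)%N -> (p < 4)%N -> (q < 4)%N ->
  volume g o [tuple u`_i; u`_j; u`_p; u`_q] =
  levi_civita R i j p q.
Proof.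
move=> i4 j4 p4 q4; rewrite /levi_civita -cofactor_detE /volume.
pose G := \matrix_(i, j) g (tnth u i) (tnth (oriented_onb g o) j).
pose k (a : 'I_4) : 'I_4 := inord (nth 0 [:: i; j; p; q] a)%N.
have kE a : k a = nth 0 [:: i; j; p; q] a :> nat.
  by rewrite inordK//; case: a => [[|[|[|[|//]]]] ?].
have -> : \det (\matrix_(a < 4, b < 4) (nth 0 [:: i; j; p; q] a == b)%N%:R)
  = \det ((\matrix_(a < 4, b < 4) (k a == b)%:R) *m G) :> R.
  rewrite det_mulmx du mulr1; congr (\det _); apply/matrixP => a b.
  by rewrite !mxE -val_eqE /= kE.
congr (\det _); apply/matrixP => a b; rewrite !mxE (bigD1 (k a))//= big1 ?addr0.
  rewrite !mxE (eqxx (k a)) mul1r; congr (g _ _); rewrite !(tnth_nth 0) kE.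
  by case: a => [[|[|[|[|//]]]] ?].
by move=> c /negPf ck; rewrite !mxE eq_sym ck mul0r.
Qed.

Lemma volume_swap12 (x y z w : T) :
  volume g o [tuple y; x; z; w] = - volume g o [tuple x; y; z; w].
Proof.
pose s : 'S_4 := tperm (ord4 0) (ord4 1).
rewrite /volume; set M := \matrix_(i, j) g (tnth [tuple x; _; _; _] i) _.
have -> : \matrix_(i, j) g (tnth [tuple y; x; z; w] i) (tnth (oriented_onb g o) j)
    = row_perm s M.
  apply/matrixP => i j; rewrite !mxE; congr (g _ _); rewrite permE /=.
  by case: i => [[|[|[|[|//]]]] ?].
by rewrite row_permE det_mulmx det_perm odd_tperm /= expr1 mulN1r.
Qed.

Lemma volume_swap34 (x y z w : T) :
  volume g o [tuple x; y; w; z] = - volume g o [tuple x; y; z; w].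
Proof.
pose s : 'S_4 := tperm (ord4 2) (ord4 3).
rewrite /volume; set M := \matrix_(i, j) g (tnth [tuple x; y; z; _] i) _.
have -> : \matrix_(i, j) g (tnth [tuple x; y; w; z] i) (tnth (oriented_onb g o) j)
    = row_perm s M.
  apply/matrixP => i j; rewrite !mxE; congr (g _ _); rewrite permE /=.
  by case: i => [[|[|[|[|//]]]] ?].
by rewrite row_permE det_mulmx det_perm odd_tperm /= expr1 mulN1r.
Qed.

Lemma hodge_bivector b : hodge g o b \in bivectors.
Proof.
apply/bivectorsP => x y; rewrite !hodgeE -mulrN -sumrN; congr (_ * _).
by apply: eq_bigr => p _; rewrite -sumrN; apply: eq_bigr => q _; rewrite volume_swap12 mulNr.
Qed.

(** The double contraction with the volume form counts every coordinate plane
    twice, which cancels the factor 1/2 of the Hodge star. *)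
Lemma hodge_skew_dot b i j : b \in bivectors -> (i < 4)%N -> (j < 4)%N ->
  hodge g o b u`_i u`_j =
  skew_dot (levi_civita R i j) (fun p q => b u`_p u`_q).
Proof.
move=> /bivectorsP sb i4 j4; rewrite hodgeE.
have v3 a x y z z' w : volume g o [tuple x; y; a *: z + z'; w] =
    a * volume g o [tuple x; y; z; w] + volume g o [tuple x; y; z'; w].
  have tE t : [tuple if k == ord4 2 then t else tnth [tuple x; y; 0; w] k | k < 4]
      = [tuple x; y; t; w].
    by apply: eq_from_tnth => k; rewrite tnth_mktuple; case: k => -[|[|[|[|]]]].
  by rewrite -(tE (a *: z + z')) -(tE z) -(tE z') volume_linear.
have v4 a x y z w w' : volume g o [tuple x; y; z; a *: w + w'] =
    a * volume g o [tuple x; y; z; w] + volume g o [tuple x; y; z; w'].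
  by rewrite volume_swap34 v3 !(volume_swap34 _ _ z) opprD mulrN !opprK.
have bq x y p p' : bilinear2 (fun q q' => volume g o [tuple x; y; p; q] * b p' q').
  split=> [a q q' z|a q z z']; first by rewrite v4 mulrDl mulrA.
  by rewrite linearP mulrDr mulrCA.
have bp x y : bilinear2 (fun p p' => \sum_(q < 4) volume g o [tuple x; y; p; u`_q] * b p' u`_q).
  apply: bilinear2_sum => q; split=> [a p p' z|a p z z'].
    by rewrite v3 mulrDl mulrA.
  by rewrite linearP !(add_lfunE, scale_lfunE) mulrDr mulrCA.
under eq_bigr => p _ do rewrite (onb_sumE dimT ou (bq _ _ p p)).
rewrite (onb_sumE dimT ou (bp _ _)).
have d0 (h : nat -> nat -> R) : (forall p q, h p q = - h q p) -> skew h.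
  move=> sh; split=> // p.
  by apply/eqP; have /eqP := sh p p; rewrite -addr_eq0 -mulr2n mulrn_eq0.
rewrite (skew_sum2 (h := fun p q => volume g o [tuple u`_i; u`_j; u`_p; u`_q])
  (h' := fun p q => b u`_p u`_q)).
- rewrite mulKf ?pnatr_eq0// /skew_dot.
  have V p q := @volume_frame i j p q i4 j4.
  by rewrite (V 0 1 isT isT) (V 0 2 isT isT) (V 0 3 isT isT) (V 2 3 isT isT)
    (V 3 1 isT isT) (V 1 2 isT isT).
- by apply: d0 => p q; exact: volume_swap34.
- by apply: d0 => p q; exact: sb.
Qed.

Lemma hodge_frame b (a : 'I_3) : b \in bivectors ->
  let p := opposite_pair a in
  hodge g o b u`_0 u`_a.+1 = b u`_p.1 u`_p.2 /\
  hodge g o b u`_p.1 u`_p.2 = b u`_0 u`_a.+1.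
Proof.
move=> sb p; have a4 : (a.+1 < 4)%N by rewrite ltnS.
have p4 : (p.1 < 4)%N /\ (p.2 < 4)%N by rewrite /p; case: a {p a4} => [[|[|[|//]]] ?].
case: p4 => p1 p2; rewrite (@hodge_skew_dot b 0 a.+1 sb isT a4) (hodge_skew_dot sb p1 p2).
exact: levi_civita_dual.
Qed.

Lemma LambdaP (s : bool) b : reflect
  (b \in bivectors /\ forall a : 'I_3, let p := opposite_pair a in
     b u`_p.1 u`_p.2 = (-1) ^+ s * b u`_0 u`_a.+1)
  (b \in Lambda g o s).
Proof.
have -> : (b \in Lambda g o s) = (b \in bivectors) && (hodge g o b == (-1) ^+ s *: b).
  by rewrite -mem_leigenspace; exact: memv_cap.
have ee : (-1) ^+ s * (-1) ^+ s = 1 :> R by rewrite -expr2 sqrr_sign.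
apply: (iffP andP) => [[sb /eqP hb]|[sb eb]]; split; [exact: sb| |exact: sb|].
  by move=> a p; have [<- _] := hodge_frame a sb; rewrite hb !scale_lfunE.
apply/eqP; apply: (bivector_eq (hodge_bivector b) (memvZ _ sb)).
move=> a; have [h1 h2] := hodge_frame a sb.
by rewrite /= h1 h2 !scale_lfunE eb /GRing.scale /= mulrA ee mul1r.
Qed.

Lemma Lambda_eq s b b' : b \in Lambda g o s -> b' \in Lambda g o s ->
  (forall a : 'I_3, b u`_0 u`_a.+1 = b' u`_0 u`_a.+1) -> b = b'.
Proof.
move=> /LambdaP[sb eb] /LambdaP[sb' eb'] bb.
by apply: bivector_eq => // a; split; [exact: bb|rewrite /= eb eb' bb].
Qed.

(** The three component functionals b |-> b(u_0, u_c) are dual to the basis of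
    Lambda^s, and by [Lambda_eq] they determine its elements; this gives both
    independence and generation in [Lambda_basis_basis]. *)
Lemma Lambda_basis_dual s (a c : 'I_3) :
  (Lambda_basis g s u)`_a u`_0 u`_c.+1 = (a == c)%:R.
Proof.
have c4 : (c.+1 < 4)%N by rewrite ltnS.
rewrite (@Lambda_basis_frame s a 0 c.+1 isT c4) delta_row3 bivec_row3 mxE !inordK//.
by case: a c {c4} => [[|[|[|//]]] ?] [[|[|[|//]]] ?].
Qed.

Lemma Lambda_basis_mem s (a : 'I_3) : (Lambda_basis g s u)`_a \in Lambda g o s.
Proof.
apply/LambdaP; split.
  by case: a => [[|[|[|//]]] ?] /=; rewrite memvD ?memvZ ?wedge_bivector.
move=> c; have [p1 p2] : ((opposite_pair c).1 < 4)%N /\ ((opposite_pair c).2 < 4)%N.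
  by case: c => [[|[|[|//]]] ?].
rewrite /= Lambda_basis_dual (@Lambda_basis_frame s a _ _ p1 p2) delta_row3 bivec_row3 mxE.
rewrite !inordK// /bivec_entry {p1 p2}.
by case: a c => [[|[|[|//]]] ?] [[|[|[|//]]] ?]; rewrite /= ?(mulr0, oppr0).
Qed.

Lemma Lambda_basis_basis s : basis_of (Lambda g o s) (Lambda_basis g s u).
Proof.
apply/andP; split.
  rewrite eqEsubv; apply/andP; split.
    apply/span_subvP => b /nthP-/(_ 0)[i ib <-]; case: i ib => [|[|[|//]]] _.
    - exact: (Lambda_basis_mem s (ord3 0)).
    - exact: (Lambda_basis_mem s (ord3 1)).
    - exact: (Lambda_basis_mem s (ord3 2)).
  apply/subvP => b bL.
  have -> : b = \sum_(a < 3) b u`_0 u`_a.+1 *: (Lambda_basis g s u)`_a.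
    apply: (Lambda_eq bL); first by rewrite memv_suml// => a _; rewrite memvZ ?Lambda_basis_mem.
    move=> c; rewrite !sum_lfunE (bigD1 c)//= !scale_lfunE Lambda_basis_dual eqxx.
    rewrite big1 ?addr0 => [|a /negPf ac]; first by rewrite /GRing.scale /= mulr1.
    by rewrite !scale_lfunE Lambda_basis_dual ac /GRing.scale /= mulr0.
  by apply: memv_suml => a _; rewrite memvZ// memv_span// mem_nth.
apply/freeP => k k0 c; have := congr1 (fun b : tensor2 T => b u`_0 u`_c.+1) k0.
rewrite /= !sum_lfunE !zero_lfunE => <-.
rewrite (bigD1 c)//= !scale_lfunE Lambda_basis_dual eqxx.
rewrite big1 ?addr0 => [|a /negPf ac]; first by rewrite /GRing.scale /= mulr1.
by rewrite !scale_lfunE Lambda_basis_dual ac /GRing.scale /= mulr0.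
Qed.
End FrameTensors.

(** * The adapted frame *)

Section AdaptedFrame.
Context {R : realType} {T : vectType R}.
Variable g : {dot T for idfun : R -> R}.
Hypothesis dimT : \dim {:T} = 4%N.
Variable Rm : tensor4 T.
Hypothesis hRm : algebraic_curvature Rm.

Lemma pairing_frame (f u : 4.-tuple T) (O M : 'M[R]_4) (h : tensor2 T) :
  (forall i, tnth u i = \sum_j O i j *: tnth f j) ->
  pairing M (fun i j => h u`_i u`_j) =
  pairing (O^T *m M *m O) (fun i j => h f`_i f`_j).
Proof.
move=> uE; rewrite /pairing.
have hE i j : M i j * h u`_i u`_j =
    \sum_k \sum_l O i k * M i j * O j l * h f`_k f`_l.
  rewrite -!tnth_nth !uE form_sum mulr_sumr; apply: eq_bigr => k _.
  by rewrite mulr_sumr; apply: eq_bigr => l _; rewrite !(tnth_nth 0); ring.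
under eq_bigr => i _ do under eq_bigr => j _ do rewrite hE.
under eq_bigr => i _ do rewrite exchange_big /=.
rewrite exchange_big; apply: eq_bigr => k _ /=.
under eq_bigr => i _ do rewrite exchange_big /=.
rewrite exchange_big; apply: eq_bigr => l _ /=.
rewrite mxE mulr_suml exchange_big; apply: eq_bigr => j _ /=.
by rewrite mxE !mulr_suml; apply: eq_bigr => i _; rewrite mxE.
Qed.

(** A change of frame is carried out in the last two arguments, then, by the pair
    symmetry of the curvature tensor, in the first two. *)
Lemma pairing_frame_curv (f u : 4.-tuple T) (O M N : 'M[R]_4) :
  (forall i, tnth u i = \sum_j O i j *: tnth f j) ->
  pairing M (fun i j => pairing N (frame_curv Rm u i j)) =
  pairing (O^T *m M *m O)
    (fun i j => pairing (O^T *m N *m O) (frame_curv Rm f i j)).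
Proof.
move=> uE; have [_ _ rs _] := hRm.
under eq_pairing => i j _ _ do rewrite (pairing_frame N (Rm u`_i u`_j) uE).
rewrite (pairing_exchange M _ (fun i j k l => Rm u`_i u`_j f`_k f`_l)).
under eq_pairing => k l _ _.
  under eq_pairing => i j _ _ do rewrite rs.
  rewrite (pairing_frame M (Rm f`_k f`_l) uE).
  under eq_pairing => i j _ _ do rewrite rs.
  over.
by rewrite -(pairing_exchange _ _ (frame_curv Rm f)).
Qed.

Section Diagonal.
Variable u : 4.-tuple T.
Hypothesis ou : orthonormal g u.
Hypothesis du : diagonal_components (frame_curv Rm u).

Let r := frame_curv Rm u.
Let dc := diagonal_curv (r 0 1 0 1) (r 0 2 0 2) (r 0 3 0 3)
  (r 0 1 2 3) (r 0 2 3 1) (r 0 3 1 2) (r 2 3 2 3) (r 3 1 3 1) (r 1 2 1 2).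

Let rE i j k l : (i < 4)%N -> (j < 4)%N -> (k < 4)%N -> (l < 4)%N ->
  r i j k l = dc i j k l.
Proof. exact: (diagonal_componentsE (frame_curv_symmetries hRm u) du). Qed.

Let ricciE i j : (i < 4)%N -> (j < 4)%N ->
  ricci_components r i j = ricci_components dc i j.
Proof. by move=> i4 j4; apply: eq_bigr => k _; rewrite rE. Qed.

Let weylE i j k l : (i < 4)%N -> (j < 4)%N -> (k < 4)%N -> (l < 4)%N ->
  weyl_components r i j k l = weyl_components dc i j k l.
Proof.
move=> i4 j4 k4 l4; rewrite /weyl_components rE// !ricciE//.
by under eq_bigr do rewrite ricciE//.
Qed.

(** The Ricci contraction of a tensor with diagonal components is diagonal. *)
Lemma einstein_eigenvectors (i : 'I_4) : eigenvector g (einstein g Rm) (tnth u i).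
Proof.
have /orthonormal_tupleP oE := ou; split.
  apply/eqP => u0; have := oE i i; rewrite u0 linear0l eqxx => /esym/eqP.
  by rewrite oner_eq0.
exists (einstein g Rm (tnth u i) (tnth u i)) => y.
have el a z z' : einstein g Rm (tnth u i) (a *: z + z') =
    a * einstein g Rm (tnth u i) z + einstein g Rm (tnth u i) z'.
  by rewrite /einstein ricci_linearr dotDZr; ring.
have e0 j : j != i -> einstein g Rm (tnth u i) (tnth u j) = 0.
  rewrite eq_sym => ij; rewrite /einstein oE (negPf ij) mulr0 mul0r subr0.
  rewrite (ricci_frame dimT _ _ _ ou) !(tnth_nth 0) -[LHS]/(ricci_components r i j).
  by rewrite ricciE// ricci_diagonal// val_eqE (negPf ij) mul0r.
rewrite {1}(orthonormal_expand dimT y ou).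
have -> (c : 'I_4 -> R) : einstein g Rm (tnth u i) (\sum_j c j *: tnth u j) =
    \sum_j c j * einstein g Rm (tnth u i) (tnth u j).
  elim/big_rec2: _ => [|j z t _ <-]; last exact: el.
  by have := el (-1) 0 0; rewrite scaler0 addr0 mulN1r addNr.
rewrite (bigD1 i)//= big1 ?addr0 => [|j ji]; last by rewrite e0// mulr0.
by rewrite dotC mulrC.
Qed.

Lemma weyl_eigenbivectors (s : bool) (a : 'I_3) :
  exists c : R, weyl_op g Rm (Lambda_basis g s u)`_a = c *: (Lambda_basis g s u)`_a.
Proof.
have bianchi : r 0 1 2 3 + r 0 2 3 1 + r 0 3 1 2 = 0.
  (* The cyclic identity in the vectors u_1, u_2, u_3 with u_0 in the last slot. *)
  case: (hRm) => r1 r2 rs b; have := b u`_2 u`_3 u`_1 u`_0.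
  rewrite (r2 u`_2) (r2 u`_3) (r2 u`_1) -!opprD => /eqP; rewrite oppr_eq0 => /eqP.
  by rewrite /r /frame_curv !(rs u`_0).
have [c cE] := weyl_diagonal (r 0 1 0 1) (r 0 2 0 2) (r 0 3 0 3)
  (r 2 3 2 3) (r 3 1 3 1) (r 1 2 1 2) s a bianchi.
exists c; apply: (tensor2_eq dimT ou) => i j i4 j4.
rewrite (weyl_op_frame dimT _ _ _ _ ou) !scale_lfunE (Lambda_basis_frame ou s a i4 j4).
rewrite delta_row3 bivec_row3 mxE !inordK// /GRing.scale /= -cE//.
apply: eq_bigr => p _; apply: eq_bigr => q _.
rewrite (weyl_frame dimT _ ou)// weylE// (Lambda_basis_frame ou s a)// !inord_val.
by rewrite mulrC.
Qed.
End Diagonal.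
End AdaptedFrame.

Theorem theorem1p1 (R : realType) (T : vectType R) (dimT : \dim {:T} = 4%N)
    (g : {dot T for idfun : R -> R}) (o : orientation T) (Rm : tensor4 T)
    (hRm : algebraic_curvature Rm) (hWE : weakly_einstein g Rm) :
  exists u : 4.-tuple T,
    [/\ orthonormal g u,
        positive o u,
        forall i : 'I_4, eigenvector g (einstein g Rm) (tnth u i)
      & forall s : bool,
          diagonalizes (Lambda g o s) (Lambda_basis g s u) (weyl_op g Rm)].
Proof.
have /andP[of_ posf] := oriented_onbP g o dimT.
set f := oriented_onb g o in of_ posf.
pose r := frame_curv Rm f; have sr : curvature_symmetries r := frame_curv_symmetries hRm f.
have [c cE] := weakly_einstein_frame dimT of_ hWE.
have sym s := tr_curv_block s s sr.
have [P [Q [rP rQ dA dB dZ]]] := paired_rotations (isT : odd 3) (sym false) (sym true)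
  (curv_blocks_intertwine sr cE).
have [O [[OO dO] OP]] := rotation_lift rP rQ.
pose u := [tuple \sum_j O i j *: tnth f j | i < 4].
have uE i : tnth u i = \sum_j O i j *: tnth f j by rewrite tnth_mktuple.
have ouf i j : g (tnth u i) (tnth f j) = O i j by rewrite uE orthonormal_coef.
have ou : orthonormal g u.
  apply/orthonormal_tupleP => i j; rewrite [in LHS]uE dot_suml.
  have -> : (i == j)%:R = (O *m O^T) i j by rewrite OO mxE.
  by rewrite mxE; apply: eq_bigr => k _; rewrite dotC ouf mxE.
(* In the frame u the blocks are those of f conjugated by P and Q. *)
have blocks s t : curv_block (frame_curv Rm u) s t =
    (if s then Q else P) *m curv_block r s t *m (if t then Q else P)^T.
  apply: curv_block_conj OP => M N; exact: pairing_frame_curv.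
have du : diagonal_components (frame_curv Rm u).
  apply: diagonal_blocks_components; rewrite ?blocks//; exact: frame_curv_symmetries.
exists u; split=> //.
- have [b bb oE] := orientation_class o.
  move: posf; rewrite !oE (orthonormal_basis dimT of_) (orthonormal_basis dimT ou) /= => f0.
  suff -> : \matrix_(i, j) coord b j (tnth u i) = O *m \matrix_(i, j) coord b j (tnth f i).
    by rewrite det_mulmx dO mul1r.
  apply/matrixP => i j; rewrite !mxE uE linear_sum /=.
  by apply: eq_bigr => k _; rewrite linearZ /= mxE.
- exact: einstein_eigenvectors.
move=> s; split.
  apply: Lambda_basis_basis => //.
  rewrite -[RHS]dO; congr (\det _); apply/matrixP => i j; rewrite mxE; exact: ouf.
move=> b /nthP-/(_ 0)[i i3 <-]; exact: (weyl_eigenbivectors dimT hRm ou du s (Ordinal i3)).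
Qed.
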